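(* Let $n\ge 2$. Any nontrivial representation of $\mathrm{sl}(n+1,\mathbb{R})$ as vector fields on $\mathbb{R}^n$ is (locally) equivalent by point transformations to the following two representations, each given by its root vectors for the simple roots $\alpha_1,\dots,\alpha_n$ and their negatives, in coordinates $x_1,\dots,x_n$; moreover these two representations are equivalent to each other by a point transformation: (1) $X_{\alpha_1}=\exp(x_1)\,\partial_{x_1}$, $\quad X_{\alpha_i}=\exp(x_i)(\partial_{x_i}-\partial_{x_{i-1}})$ for $2\le i\le n$, $$X_{-\alpha_i}=\exp(-x_i)(\partial_{x_i}-\partial_{x_{i+1}})\ \text{ for } 1\le i\le n-1,\qquad X_{-\alpha_n}=\exp(-x_n)\,\partial_{x_n}.$$ (2) $X_{\alpha_i}=\exp(x_i)(\partial_{x_i}-\partial_{x_{i+1}})$ for $1\le i\le n-1$, $\quad X_{\alpha_n}=\exp(x_n)\,\partial_{x_n}$, $$X_{-\alpha_1}=\exp(-x_1)\,\partial_{x_1},\qquad X_{-\alpha_i}=\exp(-x_i)(\partial_{x_i}-\partial_{x_{i-1}})\ \text{ for } 2\le i\le n.$$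
   Context: A representation of a Lie algebra as vector fields on $\mathbb{R}^n$ is a realization of it as a Lie algebra of vector fields (under the Lie bracket). A point transformation is a local change of coordinates (local diffeomorphism), and the result is local: it concerns the form of the algebra in a neighborhood of a generic point. Two realizations are equivalent by a point transformation if a local change of coordinates carries the one Lie algebra of vector fields onto the other. The simple roots $\alpha_1,\dots,\alpha_n$ of type $A_n$ are taken with respect to a split Cartan subalgebra and are numbered consecutively along the Dynkin diagram; the root vectors for the simple roots and their negatives generate the Lie algebra, so listing them determines the realization. *)

(* Defs.v *)
From mathcomp Require Import all_boot all_order all_algebra.
From mathcomp Require Import all_classical all_reals all_analysis.

Set Implicit Arguments.
Unset Strict Implicit.
Unset Printing Implicit Defensive.

Import Order.TTheory GRing.Theory Num.Theory.
Import numFieldNormedType.Exports.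

Local Open Scope classical_set_scope.
Local Open Scope ring_scope.

Section VectorFields.
Context {R : realType} {n : nat}.
Implicit Types (U V W : set 'rV[R]_n) (f X Y : 'rV[R]_n -> 'rV[R]_n).

(* C^k on U: the iterated partial derivatives of order at most k exist and are
   continuous at every point of U.  U is always open below, so the values of f
   off U are irrelevant. *)
Fixpoint class_C (k : nat) U f : Prop :=
  (forall x, U x -> {for x, continuous f}) /\
  (if k is k'.+1 then
     forall i : 'I_n,
       (forall x, U x -> derivable f x (delta_mx 0 i)) /\
       class_C k' U (fun x => 'D_(delta_mx 0 i) f x)
   else True).

Definition smooth_on U f : Prop := forall k, class_C k U f.

(* A vector field \sum_i f_i \partial_{x_i} is the map x |-> (f_1 x, ..., f_n x);
   on a domain U only its values on U matter. *)
Definition lie_bracket X Y : 'rV[R]_n -> 'rV[R]_n :=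
  fun x => 'D_(X x) Y x - 'D_(Y x) X x.

Definition local_diffeo_with_inverse W V f g : Prop :=
  [/\ open W /\ open V,
      smooth_on W f, smooth_on V g,
      forall x, W x -> V (f x) /\ g (f x) = x
    & forall y, V y -> W (g y) /\ f (g y) = y].

(* f_* X = Y, for f defined on W *)
Definition pushes_to W f X Y : Prop :=
  forall x, W x -> 'D_(X x) f x = Y (f x).

(* f_* (L restricted to W) = M restricted to f(W) *)
Definition carries_onto W f (L M : set ('rV[R]_n -> 'rV[R]_n)) : Prop :=
  (forall X, L X -> exists2 Y, M Y & pushes_to W f X Y) /\
  (forall Y, M Y -> exists2 X, L X & pushes_to W f X Y).

Definition generically U (P : 'rV[R]_n -> Prop) : Prop :=
  exists G : set 'rV[R]_n,
    [/\ open G, G `<=` U, U `<=` closure G & forall p, G p -> P p].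

(* Near a generic point of U, some change of coordinates gives L (on U) the
   form that M (on U') has on some open part of U'. *)
Definition locally_equivalent U (L : set ('rV[R]_n -> 'rV[R]_n))
    U' (M : set ('rV[R]_n -> 'rV[R]_n)) : Prop :=
  generically U (fun p =>
    exists (W V : set 'rV[R]_n) (f g : 'rV[R]_n -> 'rV[R]_n),
      [/\ W p, W `<=` U, V `<=` U',
          local_diffeo_with_inverse W V f g & carries_onto W f L M]).

End VectorFields.

Section SpecialLinear.
Context {R : realType} {n : nat}.

Definition sl : set 'M[R]_n.+1 := [set A | \tr A = 0].

(* The split Cartan subalgebra is that of diagonal traceless matrices, and the
   simple roots are H |-> H_i - H_{i+1}. *)
Definition simple_root (i : 'I_n) (H : 'M[R]_n.+1) : R :=
  H (widen_ord (leqnSn n) i) (widen_ord (leqnSn n) i)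
  - H (lift ord0 i) (lift ord0 i).

Definition root_vector (a : 'M[R]_n.+1 -> R) (A : 'M[R]_n.+1) : Prop :=
  [/\ sl A, A != 0
    & forall H, sl H -> is_diag_mx H -> H *m A - A *m H = a H *: A].

(* The values of rho outside sl play no role. *)
Definition realization (U : set 'rV[R]_n)
    (rho : 'M[R]_n.+1 -> 'rV[R]_n -> 'rV[R]_n) : Prop :=
  [/\ forall A, sl A -> smooth_on U (rho A),
      forall (a : R) A B x, sl A -> sl B -> U x ->
        rho (a *: A + B) x = a *: rho A x + rho B x
    & forall A B x, sl A -> sl B -> U x ->
        rho (A *m B - B *m A) x = lie_bracket (rho A) (rho B) x].

Definition nontrivial (U : set 'rV[R]_n)
    (rho : 'M[R]_n.+1 -> 'rV[R]_n -> 'rV[R]_n) : Prop :=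
  exists A x, [/\ sl A, U x & rho A x != 0].

Definition given_by (rho : 'M[R]_n.+1 -> 'rV[R]_n -> 'rV[R]_n)
    (Xpos Xneg : 'I_n -> 'rV[R]_n -> 'rV[R]_n) : Prop :=
  forall i : 'I_n,
    (exists2 A, root_vector (simple_root i) A & rho A = Xpos i) /\
    (exists2 A, root_vector (fun H => - simple_root i H) A & rho A = Xneg i).

(* \partial_{x_k}, with k counted from 1 and the convention
   \partial_{x_0} = \partial_{x_{n+1}} = 0, which accounts for the end cases of
   the four families below.  The coordinate x_k is x 0 i with k = i.+1. *)
Definition partial (k : nat) : 'rV[R]_n := \row_(j < n) (j.+1 == k)%:R.

Definition X1_pos (i : 'I_n) (x : 'rV[R]_n) : 'rV[R]_n :=
  expR (x 0 i) *: (partial i.+1 - partial i).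
Definition X1_neg (i : 'I_n) (x : 'rV[R]_n) : 'rV[R]_n :=
  expR (- x 0 i) *: (partial i.+1 - partial i.+2).

Definition X2_pos (i : 'I_n) (x : 'rV[R]_n) : 'rV[R]_n :=
  expR (x 0 i) *: (partial i.+1 - partial i.+2).
Definition X2_neg (i : 'I_n) (x : 'rV[R]_n) : 'rV[R]_n :=
  expR (- x 0 i) *: (partial i.+1 - partial i).

End SpecialLinear.

Arguments sl : clear implicits.

(* Main.v *)
(* Write [rho A x = (tr (A M_j(x)))_j] with traceless matrices [M_j(x)].  The isotropy subalgebra
   at [x] is the annihilator [L] of the [M_j(x)]; it is closed under brackets exactly when
   [[L, M_j] <= span M], and since [L] has codimension at most [n], [ad m] has rank at most [2n]
   for every [m] in the span.  This forces every nonzero [m] to be a nilpotent of rank one, so the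
   [M_j(x)] are linearly independent and share their column [u(x)] or their row: the isotropy is
   the stabilizer of a line or of a hyperplane of [R^(n+1)].  Composing with [A |-> - A^T]
   exchanges the two cases, so assume the former.  Then [x |-> [u(x)]] is an equivariant
   map to projective space and a local diffeomorphism by transitivity; in logarithmic homogeneous
   coordinates (after a conjugation making [u(p)] positive) it carries [rho] to the first model,
   and [A |-> - A^T] together with [x |-> - x] exchanges the two models.

   Fixed points do not occur: the same count shows that [sl_(n+1)] has no nontrivial linear
   representation of dimension [n], so at a fixed point [p] all first derivatives vanish, and
   writing each field as a sum of brackets gives [|rho| <= eps |rho|] near [p].  Hence the set of
   fixed points is open and closed. *)

From HB Require Import structures.
Require Import Defs.
From mathcomp Require Import all_boot all_order all_algebra.
From mathcomp Require Import all_classical all_reals all_analysis.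
From mathcomp Require Import ring lra zify.

Set Implicit Arguments.
Unset Strict Implicit.
Unset Printing Implicit Defensive.
Import Order.TTheory GRing.Theory Num.Theory.
Import numFieldNormedType.Exports.

Local Open Scope ring_scope.


(** * Subalgebras of small codimension *)

(** Why a bound on the rank of [ad m] forces rank one. Over the reals [m] need not have an
    eigenvalue, so the rank is bounded from below by explicit spaces of matrices on which [ad m] is
    injective; such a space has dimension at most [2n]. The products [w psi], with [w] an arbitrary
    column and [psi] a suitable covector, contribute [n + 1] dimensions, so two such covectors are
    already too many. This leaves only [m = c + B] with [B] of rank at most two, and a second count
    leaves rank one. Equality then holds throughout, so the span has dimension exactly [n]. The same
    count applied to the part of the span orthogonal to [m] gives [tr (m^2) = 0], which removes the
    scalar [c].

    In the chart, the factorization [M_j = u psi_j] is not canonical, so the derivative of [u] along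
    a field is known only up to a multiple of [u]. Differences of logarithms of the entries of [u]
    do not see this ambiguity. *)

Section Algebra.
Variable F : numFieldType.

(** Pairs of distinct unit vectors test the off-diagonal entries; [e_i - e_j] against [e_i + e_j]
    compares diagonal ones. *)
Lemma scalar_of_orthogonal (q : nat) (C : 'M[F]_q) :
  (forall (y : 'rV_q) (w : 'cV_q), y *m w = 0 -> y *m C *m w = 0) ->
  exists c, C = c%:M.
Proof.
move=> CP.
have offdiag i j : i != j -> C i j = 0.
  move=> ij; have := CP (delta_mx 0 i) (delta_mx j 0).
  rewrite -!rowE -colE => /(_ _)/matrixP/(_ 0 0); rewrite !mxE; apply.
  by apply/matrixP => a b; rewrite !mxE (negPf ij).
have diag i j : C i i = C j j.
  case: (eqVneq i j) => [->//|ij].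
  have := CP (delta_mx 0 i - delta_mx 0 j) (delta_mx i 0 + delta_mx j 0).
  rewrite !mulmxDr !mulmxBl -!rowE -!colE => /(_ _)/matrixP/(_ 0 0).
  rewrite !mxE (offdiag _ _ ij) (offdiag j i) 1?eq_sym// .
  rewrite subr0 sub0r => h.
  apply/eqP; rewrite -subr_eq0; apply/eqP/h.
  apply/matrixP => a b; rewrite !mxE !ord1 !eqxx (negPf ij) eq_sym (negPf ij) !andbT.
  by rewrite subr0 sub0r subrr.
case: q C CP offdiag diag => [|q] C _ offdiag diag.
  by exists 0; rewrite flatmx0; apply/esym/flatmx0.
exists (C 0 0); apply/matrixP => i j; rewrite !mxE.
by case: (eqVneq i j) => [->|/offdiag ->]; [rewrite (diag _ 0) mulr1n|].
Qed.

(** A right inverse [X] of [A] reduces this to the square case: [B X] is a scalar, and [B] vanishes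
    on the range of [1 - X A] because [A] does. *)
Lemma proportional_of_orthogonal (q N : nat) (A B : 'M[F]_(q, N)) :
  row_free A ->
  (forall (y : 'rV_q) (z : 'cV_N), y *m A *m z = 0 -> y *m B *m z = 0) ->
  exists c, B = c *: A.
Proof.
move=> /row_freeP[X AX] AB.
have [y w yw|c Cc] := @scalar_of_orthogonal q (B *m X).
  have := AB y (X *m w).
  by rewrite !mulmxA -(mulmxA y A) AX mulmx1; apply.
exists c; have D0 : B *m (1%:M - X *m A) = 0.
  apply/matrixP => i k.
  have := AB (delta_mx 0 i) ((1%:M - X *m A) *m delta_mx k 0).
  rewrite !mulmxA -(mulmxA _ A) mulmxBr mulmx1 mulmxA AX mul1mx subrr mulmx0 mul0mx.
  move=> /(_ erefl)/matrixP/(_ 0 0).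
  by rewrite -colE -(mulmxA _ B) -rowE [LHS]mxE [LHS]mxE [RHS]mxE => ->; rewrite mxE.
move/eqP: D0; rewrite mulmxBr mulmx1 subr_eq0 => /eqP ->.
by rewrite mulmxA Cc mul_scalar_mx.
Qed.

Lemma mxtrace_mxvec (N : nat) (r : 'rV[F]_(N * N)) (m : 'M[F]_N) :
  r *m (mxvec m)^T = (\tr ((vec_mx r)^T *m m))%:M.
Proof.
apply/rowP => z; rewrite ord1 [RHS]mxE mulr1n.
transitivity (\sum_i \sum_j r 0 (mxvec_index i j) * m i j).
  rewrite mxE (reindex _ (curry_mxvec_bij N N)) pair_bigA.
  by apply: eq_bigr => -[i j] _ /=; rewrite mxE mxvecE.
rewrite exchange_big; apply: eq_bigr => i _ /=; rewrite mxE.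
by apply: eq_bigr => j _; rewrite !mxE.
Qed.

Section Brackets.
Variables (n : nat) (M : 'I_n -> 'M[F]_n.+1).

Definition annihilates (A : 'M[F]_n.+1) := forall j, \tr (A *m M j) = 0.

(** Double annihilator for the trace form: a column of the cokernel of the vectorized [M j], read as
    a matrix, is an annihilator, so the vectorized [Q] vanishes on it. *)
Lemma span_of_annihilated (Q : 'M[F]_n.+1) :
  (forall A, annihilates A -> \tr (A *m Q) = 0) ->
  exists c : 'I_n -> F, Q = \sum_j c j *: M j.
Proof.
move=> QP; pose S := \matrix_j mxvec (M j).
have : (mxvec Q <= S)%MS.
  rewrite submxE; apply/eqP/trmx_inj/row_matrixP => k.
  pose A := (vec_mx (row k (cokermx S)^T))^T.
  have pairE (m : 'M[F]_n.+1) : row k (cokermx S)^T *m (mxvec m)^T = (\tr (A *m m))%:M.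
    by rewrite mxtrace_mxvec.
  rewrite trmx_mul row_mul pairE QP ?trmx0 ?row0 ?scalemx1 ?raddf0 // => j.
  have : row j S *m cokermx S = 0 by rewrite -row_mul mulmx_coker row0.
  rewrite rowK => /(congr1 trmx); rewrite trmx_mul trmx0 => /row_matrixP/(_ k).
  by rewrite row_mul pairE row0 => /matrixP/(_ 0 0); rewrite !mxE eqxx mulr1n.
case/submxP => D QD; exists (fun j => D 0 j).
rewrite -[Q]mxvecK QD mulmx_sum_row linear_sum; apply: eq_bigr => j _.
by rewrite linearZ /= rowK mxvecK.
Qed.

Hypothesis closed_bracket :
  forall A B, annihilates A -> annihilates B -> annihilates (A *m B - B *m A).

Lemma trace_bracket (A B C : 'M[F]_n.+1) :
  \tr (A *m (B *m C - C *m B)) = \tr ((A *m B - B *m A) *m C).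
Proof.
rewrite mulmxBr mulmxBl !raddfB /= !mulmxA; congr (_ - _).
by rewrite mxtrace_mulC mulmxA.
Qed.

Let S := (<<[tuple M i | i < n]>>)%VS.

Lemma mem_span_sum (c : 'I_n -> F) : \sum_j c j *: M j \in S.
Proof.
by apply: memv_suml => j _; apply/memvZ/memv_span/tnthP; exists j; rewrite tnth_mktuple.
Qed.

Lemma span_sumP (m : 'M[F]_n.+1) : m \in S -> exists c : 'I_n -> F, m = \sum_j c j *: M j.
Proof.
move=> mS; exists (fun j => coord [tuple M i | i < n] j m); rewrite {1}(coord_span mS).
by apply: eq_bigr => i _; rewrite -tnth_nth tnth_mktuple.
Qed.

Lemma dim_span_le : (\dim S <= n)%N.
Proof. by rewrite (leq_trans (dim_span _)) // size_tuple. Qed.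

(** By invariance of the trace form, pairing [[m, A]] with an annihilator [B] is, up to sign,
    pairing [m] with [[B, A]], which is again an annihilator. *)
Lemma bracket_mem_span (m A : 'M[F]_n.+1) : m \in S -> annihilates A ->
  m *m A - A *m m \in S.
Proof.
move=> /span_sumP[c ->] LA.
have [B LB|d ->] := @span_of_annihilated
  ((\sum_j c j *: M j) *m A - A *m (\sum_j c j *: M j)); last exact: mem_span_sum.
rewrite -opprB mulmxN raddfN /= trace_bracket mulmx_sumr.
rewrite [X in - X](_ : _ = 0) ?oppr0 // linear_sum big1 //= => i _.
by rewrite -scalemxAr linearZ /= closed_bracket // mulr0.
Qed.

(* The annihilator of the [M j] has codimension at most [n], and [ad m] maps it into [S']. *)
Lemma dim_ad_injective (D : vectType F) (P : D -> 'M[F]_n.+1) (m : 'M[F]_n.+1)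
    (S' : {vspace 'M[F]_n.+1}) :
  linear P ->
  (forall A, annihilates A -> m *m A - A *m m \in S') ->
  (forall d, m *m P d = P d *m m -> d = 0) ->
  (\dim {:D} <= n + \dim S')%N.
Proof.
move=> Plin adS' inj.
have Tlin : linear (fun d => \row_j \tr (P d *m M j)).
  by move=> a u v; apply/rowP => j;
     rewrite !mxE Plin mulmxDl -scalemxAl raddfD /= linearZ.
pose T0 : {linear D -> 'rV[F]_n} := HB.pack (fun d => \row_j \tr (P d *m M j))
   (GRing.isLinear.Build _ _ _ _ _ Tlin).
have adlin : linear (fun d => m *m P d - P d *m m).
  move=> a u v; rewrite Plin mulmxDl mulmxDr -scalemxAl -scalemxAr opprD addrACA.
  by rewrite scalerBr.
pose ad0 : {linear D -> 'M[F]_n.+1} := HB.pack (fun d => m *m P d - P d *m m)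
   (GRing.isLinear.Build _ _ _ _ _ adlin).
pose T := linfun T0; pose ad := linfun ad0.
(* Rank-nullity twice: [T] has rank at most [n], and on its kernel [ad] is injective with values in
   [S']. *)
rewrite -(limg_ker_dim T fullv) capfv addnC leq_add //.
  by rewrite (leq_trans (dimvS (subvf _))) // dimvf /dim /= mul1n.
have kad : (lker T :&: lker ad)%VS = 0%VS.
  apply/eqP; rewrite -subv0; apply/subvP => d /memv_capP[_].
  by rewrite memv_ker lfunE /= subr_eq0 memv0 => /eqP/inj ->.
rewrite -(limg_ker_dim ad (lker T)) kad dimv0 add0n; apply: dimvS.
apply/subvP => _ /memv_imgP[d dT ->]; rewrite lfunE /=; apply: adS' => j.
by move: dT; rewrite memv_ker lfunE /= => /eqP/rowP/(_ j); rewrite !mxE.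
Qed.

(** The contrapositive of [proportional_of_orthogonal], rescaled. These test vectors detect
    injectivity of [ad m] without recourse to eigenvectors. *)
Lemma not_orthogonal_pairing (q N : nat) (A B : 'M[F]_(q, N)) :
  row_free A -> (~ exists c, B = c *: A) ->
  exists (y : 'rV_q) (z : 'cV_N), y *m A *m z = 0 /\ y *m B *m z = 1%:M.
Proof.
move=> Afree nB; apply: contrapT => nyz; apply: nB.
apply: proportional_of_orthogonal => // y z yz0; apply: contrapT => /eqP yz; apply: nyz.
have [a yza] : exists a, y *m B *m z = a%:M.
  by exists ((y *m B *m z) 0 0); apply/matrixP => i j; rewrite !ord1 [RHS]mxE mulr1n.
have a0 : a != 0 by apply: contraNneq yz => a0; rewrite yza a0 raddf0.
exists (a^-1 *: y), z; rewrite -!scalemxAl yz0 yza scaler0; split=> //.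
by rewrite scale_scalar_mx mulVf.
Qed.

Hypothesis hn : (2 <= n)%N.
Hypothesis traceless : forall j, \tr (M j) = 0.

Lemma span_traceless (m : 'M[F]_n.+1) : m \in S -> \tr m = 0.
Proof.
move=> /span_sumP[c ->]; rewrite linear_sum big1 //= => i _.
by rewrite linearZ /= traceless mulr0.
Qed.

(** Two spaces of matrices are fed to [dim_ad_injective]. If [Psi m] is not a multiple of [Psi], the
    first has dimension [2n + 2], more than the bound [2n] allows. Otherwise the second has
    dimension [n + 1 + k q] with [q >= n - 1], where [k] is the rank of [m - c]. *)
Lemma dim_rank_bound (m : 'M[F]_n.+1) (S' : {vspace 'M[F]_n.+1}) :
  m \in S -> m != 0 -> (forall A, annihilates A -> m *m A - A *m m \in S') ->
  (\dim S' <= n)%N ->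
  exists2 c, \rank (m - c%:M) = 1%N & \dim S' = n.
Proof.
move=> mS m0 adS' dS'.
have nscal : ~ exists c, m = c *: 1%:M.
  move=> [c mc]; case/eqP: m0; move: (span_traceless mS).
  rewrite mc mxtraceZ mxtrace1 => /eqP; rewrite mulf_eq0 pnatr_eq0 orbF => /eqP ->.
  by rewrite scale0r.
have free1 : row_free (1%:M : 'M[F]_n.+1) by rewrite row_free_unit unitmx1.
(* Applying [[m, w0 psi0]] to [e] returns [- w0]; so [e] recovers the column [w0]. *)
have [psi0 [e []]] := not_orthogonal_pairing free1 nscal.
rewrite mulmx1 => psi0e; rewrite -mulmxA => psi0me.
(* The rows of [Psi] kill both [e] and [m e], so that adding terms ending in [Psi] does not disturb
   the recovery of [w0]. *)
have [q [Psi [qn Psifree Psie Psime]]] : exists q (Psi : 'M[F]_(q, n.+1)),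
    [/\ (n.-1 <= q)%N, row_free Psi, Psi *m e = 0 & Psi *m (m *m e) = 0].
  pose K := row_mx e (m *m e); exists (\rank (kermx K)), (row_base (kermx K)).
  have : row_base (kermx K) *m K = 0 by apply/sub_kermxP; rewrite eq_row_base.
  rewrite mul_mx_row -row_mx0 => /eq_row_mx[-> ->]; split=> //; last exact: row_base_free.
  by rewrite mxrank_ker; have := rank_leq_col K; lia.
case: (pselect (exists c, Psi *m m = c *: Psi)) => [[c Psic]|nPsi]; last first.
  have [y [z [yz ymz]]] := not_orthogonal_pairing Psifree nPsi.
  rewrite -!mulmxA in yz ymz.
  pose P (d : 'cV[F]_n.+1 * 'cV[F]_n.+1) := d.1 *m psi0 + d.2 *m (y *m Psi).
  have Plin : linear P.
    by move=> a u v; rewrite /P /= !mulmxDl -!scalemxAl scalerDr addrACA.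
  have Pinj d : m *m P d = P d *m m -> d = 0.
    case: d => w0 w; rewrite /P /= => com.
    have w00 : w0 = 0.
      move: (congr1 (mulmx^~ e) com); rewrite /= !(mulmxDl, mulmxDr) -!mulmxA.
      by rewrite psi0e Psie psi0me Psime !mulmx0 mulmx1 !addr0 => <-.
    move: (congr1 (mulmx^~ z) com); rewrite /= w00 !mul0mx !add0r -!mulmxA yz ymz.
    by rewrite !mulmx0 mulmx1 => <-.
  have := dim_ad_injective Plin adS' Pinj; rewrite dimvf.
  by rewrite [dim _](_ : _ = n.+1 * 1 + n.+1 * 1)%N //; lia.
(* Here [Psi m = c Psi], so [[m, U Y Psi] = B U Y Psi]; choosing [U] with the columns of [B U]
   independent makes this injective in [Y]. *)
pose B := m - c%:M; pose k := \rank B.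
have [U Ufull] : exists U : 'M[F]_(n.+1, k), row_full (B *m U).
  have /row_freeP[X RX] := row_base_free B.
  by exists X; rewrite -{1}(mulmx_base B) -mulmxA RX mulmx1 col_base_full.
pose P (d : 'cV[F]_n.+1 * 'M[F]_(k, q)) := d.1 *m psi0 + U *m d.2 *m Psi.
have Plin : linear P.
  move=> a u v; rewrite /P /= mulmxDr !mulmxDl -!scalemxAl -scalemxAr.
  by rewrite -!scalemxAl scalerDr addrACA.
have Pinj d : m *m P d = P d *m m -> d = 0.
  case: d => w0 Y; rewrite /P /= => com.
  have w00 : w0 = 0.
    move: (congr1 (mulmx^~ e) com); rewrite /= !(mulmxDl, mulmxDr) -!mulmxA.
    by rewrite psi0e Psie psi0me Psime !mulmx0 mulmx1 !addr0 => <-.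
  move: com; rewrite w00 !mul0mx !add0r -(mulmxA _ Psi) Psic -scalemxAr => /eqP.
  rewrite -subr_eq0 !mulmxA -!mul_scalar_mx !mulmxA -!mulmxBl -/B => /eqP.
  rewrite -(mul0mx _ Psi) => /(row_free_inj Psifree).
  rewrite -(mulmx0 _ (B *m U)) => /(row_full_inj Ufull) ->.
  by [].
have := dim_ad_injective Plin adS' Pinj; rewrite dimvf.
rewrite [dim _](_ : _ = n.+1 * 1 + k * q)%N // => dimle.
have k0 : (0 < k)%N.
  rewrite lt0n mxrank_eq0 subr_eq0; apply: contra_not_neq nscal => /eqP mc.
  by exists c; rewrite scalemx1; apply/eqP.
(* From [n + 1 + k q <= n + dim S'], [q >= n - 1], [dim S' <= n] and [k > 0], only [k = 1] and
   [dim S' = n] remain. *)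
exists c; rewrite -/B -/k; nia.
Qed.


(** Since [tr (m [m, A]) = 0], the bracket lands in the part of [S] orthogonal to [m]; the bound
    applied to that part gives it dimension [n], so it is all of [S] and [tr (m^2) = 0]. With
    [m = c + u phi] and [tr m = 0] this reads [n (n + 1) c^2 = 0]. *)
Lemma rank_one_nilpotent (m : 'M[F]_n.+1) : m \in S -> m != 0 ->
  \dim S = n /\ exists (u : 'cV_n.+1) (phi : 'rV_n.+1), m = u *m phi.
Proof.
move=> mS m0.
have adS A : annihilates A -> m *m A - A *m m \in S by exact: bracket_mem_span.
have [c rc dS] := dim_rank_bound mS m0 adS dim_span_le; split=> //.
pose t : {linear 'M[F]_n.+1 -> F^o} := mxtrace \o mulmx m.
have S'S : (S :&: lker (linfun t) <= S)%VS by exact: capvSl.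
have tr0 A : \tr (m *m (m *m A - A *m m)) = 0.
  rewrite mulmxBr raddfB /= (mxtrace_mulC m (A *m m)) (mulmxA m m A) (mxtrace_mulC _ A).
  by rewrite mulmxA subrr.
have mm0 : \tr (m *m m) = 0.
  have adS' A : annihilates A -> m *m A - A *m m \in (S :&: lker (linfun t))%VS.
    move=> LA; rewrite memv_cap adS //= memv_ker lfunE; apply/eqP; exact: tr0.
  have [_ _ dS'] := dim_rank_bound mS m0 adS' (leq_trans (dimvS S'S) dim_span_le).
  move: mS; rewrite -(eqP (_ : S :&: lker (linfun t) == S)%VS); last first.
    by rewrite eqEdim S'S dS' dS leqnn.
  by move/memv_capP => [_]; rewrite memv_ker lfunE /= => /eqP.
have [u [phi Buphi]] : exists (u : 'cV_n.+1) (phi : 'rV_n.+1), m - c%:M = u *m phi.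
  rewrite -(mulmx_base (m - c%:M)); move: (col_base _) (row_base _).
  by rewrite rc => U V; exists U, V.
have mE : m = c%:M + u *m phi by rewrite -Buphi addrC subrK.
exists u, phi; rewrite mE; suff -> : c = 0 by rewrite raddf0 add0r.
have [a phiu] : exists a, phi *m u = a%:M.
  by exists ((phi *m u) 0 0); apply/matrixP => i j; rewrite !ord1 [RHS]mxE mulr1n.
have tuphi : \tr (u *m phi) = a by rewrite mxtrace_mulC phiu mxtrace_scalar mulr1n.
have := span_traceless mS; rewrite mE mxtraceD mxtrace_scalar tuphi => /eqP.
rewrite addrC addr_eq0 => /eqP aE.
move: mm0; rewrite {1 2}mE mulmxDl !mulmxDr -scalar_mxM !mxtraceD mxtrace_scalar.
rewrite mul_scalar_mx mul_mx_scalar !mxtraceZ tuphi -mulmxA (mulmxA phi) phiu.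
rewrite mul_scalar_mx -scalemxAr mxtraceZ tuphi aE -(mulr_natr c) -(mulr_natr (c * c)) => h.
have : c ^+ 2 * (n.+1%:R * n%:R) = 0 by rewrite -h -[n.+1]addn1 natrD; ring.
move/eqP; rewrite !mulf_eq0 orbb !pnatr_eq0 => /orP[/eqP //|]; lia.
Qed.

End Brackets.

Lemma separating_covector (N : nat) (u v : 'cV[F]_N) : u != 0 -> (~ exists a, v = a *: u) ->
  exists xi : 'rV_N, xi *m u = 0 /\ xi *m v = 1%:M.
Proof.
move=> u0 nuv; have ufree : row_free u^T by rewrite /row_free rank_rV -(inj_eq trmx_inj)
  trmxK trmx0 u0.
have [|y [z [yu yv]]] := not_orthogonal_pairing (A := u^T) (B := v^T) ufree.
  by move=> [a /(congr1 trmx)]; rewrite linearZ /= !trmxK => va; apply: nuv; exists a.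
move: yu yv; rewrite (mx11_scalar y) !mul_scalar_mx -!scalemxAl => yu yv.
exists (y 0 0 *: z^T); rewrite -!scalemxAl; split; apply: trmx_inj.
  by rewrite linearZ /= trmx_mul trmxK yu trmx0.
by rewrite linearZ /= trmx_mul trmxK yv trmx1.
Qed.

(** If [u'] is not parallel to [u], a covector that kills [u] but not [u'] makes [phi'] a multiple
    of [chi], and a covector with value 1 at [u] then makes [phi] a nonzero multiple of [chi]. *)
Lemma rank_one_sum (N : nat) (u u' w : 'cV[F]_N) (phi phi' chi : 'rV[F]_N) :
  u != 0 -> phi != 0 -> u *m phi + u' *m phi' = w *m chi ->
  (exists a, u' = a *: u) \/ (exists a, phi' = a *: phi).
Proof.
move=> u0 phi0 sumE; case: (pselect (exists a, u' = a *: u)) => [|nu]; [by left|right].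
have [xi [xiu xiu']] := separating_covector u0 nu.
have phi'E : phi' = (xi *m w) 0 0 *: chi.
  rewrite -mul_scalar_mx -mx11_scalar -mulmxA -sumE mulmxDr !mulmxA xiu xiu'.
  by rewrite mul0mx mul1mx add0r.
have [eta etau] : exists eta : 'rV_N, eta *m u = 1%:M.
  have ufree : row_free u^T.
    by rewrite /row_free rank_rV -(inj_eq trmx_inj) trmxK trmx0 u0.
  have /row_freeP[X uX] := ufree.
  by exists X^T; apply: trmx_inj; rewrite trmx_mul trmxK uX trmx1.
have phiE : phi = (eta *m (w - (xi *m w) 0 0 *: u')) 0 0 *: chi.
  rewrite -mul_scalar_mx -mx11_scalar -mulmxA mulmxBl -sumE phi'E -scalemxAl -scalemxAr.
  by rewrite addrK mulmxA etau mul1mx.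
move: phiE phi'E; set b := _ 0 0; set b' := _ 0 0 => phiE ->.
have b0 : b != 0 by apply: contraNneq phi0; rewrite phiE => ->; rewrite scale0r.
by exists (b' / b); rewrite phiE scalerA divfK.
Qed.

(** Suppose [u j1] is not parallel to [u i0]. Then [phi j1] is parallel to [phi i0], and no [u k]
    can be parallel to both columns, so each [phi k] is parallel to one of these two rows, hence to
    [phi i0]. *)
Lemma rank_one_family (I : finType) (N : nat) (M : I -> 'M[F]_N) :
  (forall i, M i != 0) ->
  (forall i, exists (u : 'cV_N) (phi : 'rV_N), M i = u *m phi) ->
  (forall i j, exists (u : 'cV_N) (phi : 'rV_N), M i + M j = u *m phi) ->
  (exists (u : 'cV_N) (phi : I -> 'rV_N), forall i, M i = u *m phi i) \/
  (exists (u : I -> 'cV_N) (phi : 'rV_N), forall i, M i = u i *m phi).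
Proof.
move=> M0 /choice[u /choice[phi ME]] sumP.
have u0 i : u i != 0 by apply: contraNneq (M0 i) => ui; rewrite ME ui mul0mx.
have phi0 i : phi i != 0 by apply: contraNneq (M0 i) => p; rewrite ME p mulmx0.
have pairP i j : (exists a, u j = a *: u i) \/ (exists a, phi j = a *: phi i).
  by have [w [chi]] := sumP i j; rewrite !ME => /rank_one_sum; apply.
case: (pickP (mem I)) => [i0 _|I0]; last first.
  by left; exists 0, (fun=> 0) => i; have := I0 i; rewrite inE.
case: (pselect (forall j, exists a, u j = a *: u i0)) => [/choice[a uE]|].
  left; exists (u i0), (fun j => a j *: phi j) => j.
  by rewrite ME uE -scalemxAl -scalemxAr.
move=> /existsNP[j1 nu1]; right.
have [//|[a phi1]] := pairP i0 j1.
suff /choice[b phiE] : forall k, exists b, phi k = b *: phi i0.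
  by exists (fun k => b k *: u k), (phi i0) => k; rewrite ME phiE -scalemxAl -scalemxAr.
move=> k; have [[b uk]|//] := pairP i0 k.
have [[c uk']|[d ->]] := pairP j1 k; last by exists (d * a); rewrite phi1 scalerA.
have c0 : c != 0 by apply: contraNneq (u0 k) => c0; rewrite uk' c0 scale0r.
by case: nu1; exists (c^-1 * b); rewrite -scalerA -uk uk' scalerA mulVf // scale1r.
Qed.

(* The matrices [M j] represent a linear map [A |-> (tr (A M_j))_j] on [sl_(n+1)] whose
   kernel is a subalgebra; the two alternatives are the stabilizer of a line and of a
   hyperplane. *)
Theorem small_codimension_subalgebra (n : nat) (M : 'I_n -> 'M[F]_n.+1) :
  (2 <= n)%N -> (forall j, \tr (M j) = 0) ->
  (forall A B, annihilates M A -> annihilates M B -> annihilates M (A *m B - B *m A)) ->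
  (exists j, M j != 0) ->
  (forall c : 'I_n -> F, \sum_j c j *: M j = 0 -> forall j, c j = 0) /\
  ((exists (u : 'cV_n.+1) (phi : 'I_n -> 'rV_n.+1), forall j, M j = u *m phi j) \/
   (exists (u : 'I_n -> 'cV_n.+1) (phi : 'rV_n.+1), forall j, M j = u j *m phi)).
Proof.
move=> hn tr0 clos [j0 Mj0].
have MS j : M j \in (<<[tuple M i | i < n]>>)%VS.
  by apply/memv_span/tnthP; exists j; rewrite tnth_mktuple.
have [dimS _] := rank_one_nilpotent clos hn tr0 (MS j0) Mj0.
have indep (c : 'I_n -> F) : \sum_j c j *: M j = 0 -> forall j, c j = 0.
  have /freeP fr : free [tuple M i | i < n] by rewrite /free dimS size_tuple.
  move=> c0 j; apply: fr; rewrite -[RHS]c0; apply: eq_bigr => i _.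
  by rewrite -tnth_nth tnth_mktuple.
have sumE (c : 'I_n -> F) : exists (u : 'cV_n.+1) (phi : 'rV_n.+1),
    \sum_j c j *: M j = u *m phi.
  case: (eqVneq (\sum_j c j *: M j) 0) => [->|nz]; first by exists 0, 0; rewrite mul0mx.
  by have [_] := rank_one_nilpotent clos hn tr0 (mem_span_sum M c) nz.
have ME j : M j = \sum_i (i == j)%:R *: M i.
  by rewrite (bigD1 j) //= eqxx scale1r big1 ?addr0 // => i /negPf ->; rewrite scale0r.
split=> //; apply: rank_one_family => [j|j|i j].
- apply/eqP => Mj; have := indep (fun i => (i == j)%:R); rewrite -ME => /(_ Mj j).
  by rewrite eqxx => /eqP; rewrite oner_eq0.
- by rewrite ME; exact: sumE.
- rewrite [M i]ME [M j]ME -big_split /=.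
  under eq_bigr do rewrite -scalerDl.
  exact: sumE.
Qed.

End Algebra.

Local Open Scope classical_set_scope.
Local Open Scope ring_scope.


(** * Smooth functions of several variables *)

Section EpsilonDelta.
Context {R : realType} {V W : normedModType R}.

Lemma open_radiusP (U : set V) :
  open U <-> forall x, U x -> exists2 d : R, 0 < d & forall y, `|y - x| < d -> U y.
Proof.
split=> [oU x Ux|UP].
  have /nbhs_ballP[d /= d0 dU] := open_nbhs_nbhs (conj oU Ux).
  by exists d => // y yx; apply: dU; rewrite -ball_normE /= distrC.
rewrite openE => x /UP[d d0 dU]; apply/nbhs_ballP; exists d => // y.
by rewrite -ball_normE /= distrC; exact: dU.
Qed.

Lemma continuous_epsP (f : V -> W) (x : V) : {for x, continuous f} <->
  forall e : R, 0 < e -> exists2 d : R, 0 < d & forall y, `|y - x| < d -> `|f y - f x| < e.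
Proof.
split=> [fc e e0|fc].
  move/cvgrPdist_lt: fc => /(_ e e0)/nbhs_ballP[d /= d0 dP].
  by exists d => // y yx; rewrite distrC; apply: dP; rewrite -ball_normE /= distrC.
suff: f y @[y --> x] --> f x by [].
apply/cvgrPdist_lt => e /fc[d d0 dP]; apply/nbhs_ballP; exists d => // y.
by rewrite -ball_normE /= (distrC x) (distrC (f x)); exact: dP.
Qed.

Lemma is_derive_epsP (f : V -> W) (x v : V) (l : W) : is_derive x v f l <->
  forall e : R, 0 < e -> exists2 d : R, 0 < d &
    forall t : R, 0 < `|t| < d -> `|t^-1 *: (f (t *: v + x) - f x) - l| < e.
Proof.
have cvgE : (fun h : R => h^-1 *: (f (h *: v + x) - f x)) @ 0^' --> l <->
  forall e : R, 0 < e -> exists2 d : R, 0 < d &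
    forall t : R, 0 < `|t| < d -> `|t^-1 *: (f (t *: v + x) - f x) - l| < e.
  split=> [/cvgrPdist_lt fl e /fl/nbhs_ballP[d /= d0 dP]|fl].
    exists d => // t /andP[t0 td]; rewrite distrC; apply: dP; last by rewrite -normr_gt0.
    by rewrite -ball_normE /= sub0r normrN.
  apply/cvgrPdist_lt => e /fl[d d0 dP]; apply/nbhs_ballP; exists d => // t.
  rewrite -ball_normE /= sub0r normrN => td t0; rewrite distrC; apply: dP.
  by rewrite normr_gt0 t0.
split=> [[fd dl]|fl]; first by apply/cvgE; rewrite -dl; exact: fd.
have {}fl := cvgE.2 fl.
by apply: DeriveDef; [apply/cvg_ex; exists l | exact/cvg_lim].
Qed.

End EpsilonDelta.

Section RowNorm.
Context {R : realType} {n : nat}.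
Implicit Types x : 'rV[R]_n.

Lemma coord_le_norm x j : `|x 0 j| <= `|x|.
Proof.
by rewrite [leRHS]/Num.Def.normr /= mx_normrE; exact: (le_bigmax _ _ (0, j)).
Qed.

Lemma row_norm_le x (c : R) : 0 <= c -> (forall j, `|x 0 j| <= c) -> `|x| <= c.
Proof.
move=> c0 xc; rewrite /Num.Def.normr /= mx_normrE bigmax_le //= => -[i j] _.
by rewrite ord1.
Qed.

Lemma row_norm_lt x (c : R) : 0 < c -> (forall j, `|x 0 j| < c) -> `|x| < c.
Proof.
move=> c0 xc; rewrite /Num.Def.normr /= mx_normrE bigmax_lt //= => -[i j] _.
by rewrite ord1.
Qed.

End RowNorm.

Section Calculus.
Context {R : realType} {n : nat}.
Implicit Types (U V : set 'rV[R]_n) (g h : 'rV[R]_n -> R) (x v : 'rV[R]_n).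

Local Notation e_ i := (delta_mx 0 i : 'rV[R]_n).

(* The scalar counterpart of [class_C]. *)
Fixpoint Ck (k : nat) U h : Prop :=
  (forall x, U x -> {for x, continuous h}) /\
  (if k is k'.+1 then
     forall i : 'I_n,
       (forall x, U x -> derivable h x (e_ i)) /\ Ck k' U (fun x => 'D_(e_ i) h x)
   else True).

Lemma Ck_continuous k U h x : Ck k U h -> U x -> {for x, continuous h}.
Proof. by case: k => [|k] [hc _]; exact: hc. Qed.

Lemma Ck_derivable k U h x i : Ck k.+1 U h -> U x -> derivable h x (e_ i).
Proof. by move=> [_ /(_ i)[hd _]]; exact: hd. Qed.

Lemma Ck_derive k U h i : Ck k.+1 U h -> Ck k U (fun x => 'D_(e_ i) h x).
Proof. by move=> [_ /(_ i)[]]. Qed.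

Arguments Ck_derivable [k U h x] i _ _.
Arguments Ck_derive [k U h] i _.

Lemma CkW k U h : Ck k.+1 U h -> Ck k U h.
Proof.
elim: k h => [|k IH] h Ch; split; try by case: Ch.
by move=> i; split; [case: Ch => _ /(_ i)[] | exact/IH/Ck_derive].
Qed.

Lemma Ck_sub k U V h : V `<=` U -> Ck k U h -> Ck k V h.
Proof.
move=> VU; elim: k h => [|k IH] h [hc hd]; split; try by move=> x /VU; exact: hc.
  by [].
by move=> i; have [h1 h2] := hd i; split; [move=> x /VU; exact: h1|exact: IH].
Qed.

Lemma near_open_eq U g h x : open U -> (forall y, U y -> g y = h y) -> U x ->
  \forall y \near x, g y = h y.
Proof.
move=> oU gh Ux; apply: filterS (open_nbhs_nbhs (conj oU Ux)) => y; exact: gh.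
Qed.

Lemma near_eq_continuous U g h x : open U -> (forall y, U y -> g y = h y) -> U x ->
  {for x, continuous g} -> {for x, continuous h}.
Proof.
move=> oU gh Ux gc; suff: h y @[y --> x] --> h x by [].
rewrite -(gh x Ux); apply: cvg_trans gc; exact: (@near_eq_cvg _ _ (nbhs x) _ g h
  (near_open_eq oU gh Ux)).
Qed.

Lemma Ck_eq k U g h : open U -> (forall x, U x -> g x = h x) -> Ck k U g -> Ck k U h.
Proof.
move=> oU; elim: k g h => [|k IH] g h gh [gc gd].
  by split=> // x Ux; exact: (near_eq_continuous oU gh Ux (gc x Ux)).
split; first by move=> x Ux; exact: (near_eq_continuous oU gh Ux (gc x Ux)).
move=> i; have [g1 g2] := gd i; split.
  by move=> x Ux; exact: (near_eq_derivable (near_open_eq oU gh Ux) (g1 x Ux)).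
by apply: IH g2 => x Ux; exact: (near_eq_derive _ (near_open_eq oU gh Ux)).
Qed.

Lemma continuous_rowP (f : 'rV[R]_n -> 'rV[R]_n) x :
  {for x, continuous f} <-> forall j, {for x, continuous (fun y => f y 0 j)}.
Proof.
split=> [fc j|fc].
  apply/continuous_epsP => e e0; have /continuous_epsP/(_ e e0)[d d0 dP] := fc.
  exists d => // y /dP; apply: le_lt_trans.
  by have := coord_le_norm (f y - f x) j; rewrite !mxE.
apply/continuous_epsP => e e0.
have /choice[d dP] j : exists d : R, 0 < d /\ forall y, `|y - x| < d -> `|f y 0 j - f x 0 j| < e.
  by have /continuous_epsP/(_ e e0)[d d0 dP] := fc j; exists d.
exists (\big[Num.min/1]_j d j); first by apply/bigmin_gtP; split=> // j _; case: (dP j).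
move=> y yx; apply: row_norm_lt => // j; rewrite !mxE; case: (dP j) => _; apply.
by apply: lt_le_trans yx _; exact: bigmin_le_cond.
Qed.

Lemma class_CP k U (f : 'rV[R]_n -> 'rV[R]_n) : open U ->
  class_C k U f <-> forall j, Ck k U (fun x => f x 0 j).
Proof.
move=> oU; elim: k f => [|k IH] f.
  split=> [[fc _] j|fc]; split=> // x Ux; first by have /continuous_rowP := fc x Ux.
  by apply/continuous_rowP => j; have [c _] := fc j; exact: c.
have DE i x : derivable f x (e_ i) -> forall j,
    'D_(e_ i) f x 0 j = 'D_(e_ i) (fun y => f y 0 j) x.
  by move=> fd j; rewrite derive_mx // mxE.
split=> [[fc fd] j|fc].
  split=> [x Ux|i]; first by have /continuous_rowP := fc x Ux.
  have [d1 /IH d2] := fd i.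
  split=> [x Ux|]; first by have /derivable_mxP := d1 x Ux.
  by apply: Ck_eq (d2 j) => // x Ux; rewrite DE //; exact: d1.
have d1 i x : U x -> derivable f x (e_ i).
  move=> Ux; apply/derivable_mxP => a j; rewrite ord1.
  exact: (Ck_derivable _ (fc j)).
split=> [x Ux|i]; first by apply/continuous_rowP => j; exact: (Ck_continuous (fc j)).
split; first exact: d1.
apply/IH => j; apply: (Ck_eq (g := fun x => 'D_(e_ i) (fun y => f y 0 j) x)) => //.
  by move=> x Ux; rewrite DE //; exact: d1.
exact: Ck_derive.
Qed.

Lemma Ck_cst k U (c : R) : Ck k U (fun=> c).
Proof.
have cc c' x : {for x, continuous (fun=> c' : R)} by exact: cst_continuous.
elim: k c => [|k IH] c; first by split=> // x _; exact: cc.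
split=> [x _|i]; first exact: cc.
split=> [x _|]; first exact: derivable_cst.
rewrite (_ : (fun x => 'D_(e_ i) (fun=> c) x) = fun=> 0); first exact: IH.
by apply/funext => x; rewrite derive_cst.
Qed.

Lemma CkD k U g h : open U -> Ck k U g -> Ck k U h -> Ck k U (fun x => g x + h x).
Proof.
move=> oU; have cc k' g' h' x : Ck k' U g' -> Ck k' U h' -> U x ->
    {for x, continuous (fun x => g' x + h' x)}.
  by move=> Cg Ch Ux; exact: (continuousD (Ck_continuous Cg Ux) (Ck_continuous Ch Ux)).
elim: k g h => [|k IH] g h Cg Ch; first by split=> // x Ux; exact: (cc _ _ _ _ Cg Ch).
split=> [x Ux|i]; first exact: (cc _ _ _ _ Cg Ch).
split=> [x Ux|]; 
  first exact: (derivableD (Ck_derivable i Cg Ux) (Ck_derivable i Ch Ux)).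
apply: Ck_eq (IH _ _ (Ck_derive i Cg) (Ck_derive i Ch)) => // x Ux.
exact/esym/(deriveD (Ck_derivable i Cg Ux) (Ck_derivable i Ch Ux)).
Qed.

Lemma CkM k U g h : open U -> Ck k U g -> Ck k U h -> Ck k U (fun x => g x * h x).
Proof.
move=> oU; have cc k' g' h' x : Ck k' U g' -> Ck k' U h' -> U x ->
    {for x, continuous (fun x => g' x * h' x)}.
  by move=> Cg Ch Ux; exact: (continuousM (Ck_continuous Cg Ux) (Ck_continuous Ch Ux)).
elim: k g h => [|k IH] g h Cg Ch; first by split=> // x Ux; exact: (cc _ _ _ _ Cg Ch).
split=> [x Ux|i]; first exact: (cc _ _ _ _ Cg Ch).
split=> [x Ux|]; 
  first exact: (derivableM (Ck_derivable i Cg Ux) (Ck_derivable i Ch Ux)).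
apply: Ck_eq (CkD oU (IH _ _ (CkW Cg) (Ck_derive i Ch)) (IH _ _ (CkW Ch) (Ck_derive i Cg)))
  => // x Ux.
exact/esym/(deriveM (Ck_derivable i Cg Ux) (Ck_derivable i Ch Ux)).
Qed.

Lemma CkN k U h : open U -> Ck k U h -> Ck k U (fun x => - h x).
Proof.
move=> oU Ch; apply: Ck_eq (CkM oU (Ck_cst k U (-1)) Ch) => // x _.
by rewrite mulN1r.
Qed.

Lemma CkB k U g h : open U -> Ck k U g -> Ck k U h -> Ck k U (fun x => g x - h x).
Proof. by move=> oU Cg Ch; exact: (CkD oU Cg (CkN oU Ch)). Qed.

Lemma Ck_sum k U (I : Type) (r : seq I) (P : pred I) (F : I -> 'rV[R]_n -> R) : open U ->
  (forall i, Ck k U (F i)) -> Ck k U (fun x => \sum_(i <- r | P i) F i x).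
Proof.
move=> oU CF; elim: r => [|i r IH].
  by apply: Ck_eq (Ck_cst k U 0) => // x _; rewrite big_nil.
case Pi: (P i).
  by apply: Ck_eq (CkD oU (CF i) IH) => // x _; rewrite big_cons Pi.
by apply: Ck_eq IH => // x _; rewrite big_cons Pi.
Qed.

Lemma Ck_prod k U (I : Type) (r : seq I) (F : I -> 'rV[R]_n -> R) : open U ->
  (forall i, Ck k U (F i)) -> Ck k U (fun x => \prod_(i <- r) F i x).
Proof.
move=> oU CF; elim: r => [|i r IH].
  by apply: Ck_eq (Ck_cst k U 1) => // x _; rewrite big_nil.
by apply: Ck_eq (CkM oU (CF i) IH) => // x _; rewrite big_cons.
Qed.

Lemma is_derive_coord x v (j : 'I_n) : is_derive x v (fun y : 'rV[R]_n => y 0 j) (v 0 j).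
Proof.
have /derivable_mxP/(_ 0 j) d := @derivable_id R 'rV[R]_n x v.
apply: DeriveDef => //; have := derive_mx (@derivable_id R 'rV[R]_n x v).
by rewrite derive_id => /matrixP/(_ 0 j); rewrite mxE => ->.
Qed.

Lemma Ck_coord k U (j : 'I_n) : Ck k U (fun x => x 0 j).
Proof.
have c x : {for x, continuous (fun x : 'rV[R]_n => x 0 j)} by exact: coord_continuous.
case: k => [|k]; first by split=> // x _; exact: c.
split=> [x _|i]; first exact: c.
split=> [x _|]; first by have [] := is_derive_coord x (e_ i) j.
rewrite (_ : (fun x => 'D_(e_ i) (fun x : 'rV[R]_n => x 0 j) x) = fun=> e_ i 0 j);
  first exact: Ck_cst.
by apply/funext => x; have [] := is_derive_coord x (e_ i) j.
Qed.

End Calculus.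

Arguments Ck_derivable {R n k U h x} i _ _.
Arguments Ck_derive {R n k U h} i _.


Section LineDerivative.
Context {R : realType} {V : normedModType R}.

Lemma is_derive_lineP {W : normedModType R} (f : V -> W) x v l :
  is_derive x v f l <-> is_derive (0 : R) 1 (fun t => f (t *: v + x)) l.
Proof.
split=> /is_derive_epsP fl; apply/is_derive_epsP => e /fl[d d0 dP]; exists d => // t /dP.
  by rewrite scale0r add0r addr0 /GRing.scale /= mulr1.
by rewrite scale0r add0r addr0 /GRing.scale /= mulr1.
Qed.

Lemma is_derive_comp1 (f : R -> R) (g : V -> R) x v a l :
  is_derive (g x) 1 f a -> is_derive x v g l -> is_derive x v (f \o g) (a * l).
Proof.
move=> fa /is_derive_lineP gl; apply/is_derive_lineP.
apply: (@is_derive1_comp _ f (fun t => g (t *: v + x))) => //.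
by rewrite scale0r add0r.
Qed.

Lemma is_deriveZdir (f : V -> R) x v (s l : R) :
  is_derive x v f l -> is_derive x (s *: v) f (s * l).
Proof.
move=> fl; case: (eqVneq s 0) => [->|s0].
  by rewrite scale0r mul0r; exact: is_derive0.
have /is_derive_epsP {}fl := fl; apply/is_derive_epsP => e e0.
have s_gt0 : 0 < `|s| by rewrite normr_gt0.
have [|d d0 dP] := fl (e / `|s|); first by rewrite divr_gt0.
exists (d / `|s|); first by rewrite divr_gt0.
move=> t /andP[t0 td]; have := dP (t * s).
rewrite normrM mulr_gt0 // -ltr_pdivlMr // td => /(_ isT); rewrite ltr_pdivlMr // => {}dP.
rewrite scalerA; move: dP; rewrite -normrM mulrBl /GRing.scale /= invfM.
by rewrite mulrAC -(mulrA t^-1) mulVf // mulr1 (mulrC l).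
Qed.

Lemma MVT_line (f : V -> R) (a v : V) :
  (forall t : R, 0 <= t <= 1 -> derivable f (t *: v + a) v) ->
  exists2 t : R, 0 <= t <= 1 & f (v + a) - f a = 'D_v f (t *: v + a).
Proof.
move=> fd; pose phi (t : R) := f (t *: v + a).
have phid (t : R) : 0 <= t <= 1 -> is_derive t 1 phi ('D_v f (t *: v + a)).
  move=> /fd ft; have /is_derive_epsP fl : is_derive (t *: v + a) v f ('D_v f (t *: v + a)).
    exact: DeriveDef.
  apply/is_derive_epsP => e /fl[d d0 dP]; exists d => // s /dP.
  rewrite /phi (_ : s *: (1 : R^o) + t = s + t); last by congr (_ + _); exact: mulr1.
  by rewrite scalerDl addrA.
have [t|t|t tI tE] := @MVT_segment R phi (fun t => 'D_v f (t *: v + a)) 0 1 ler01.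
- by rewrite in_itv /= => /andP[t0 t1]; apply: phid; rewrite !ltW.
- apply: derivable_within_continuous => s; rewrite in_itv /= => /phid[]; exact.
- by exists t => //; move: tE; rewrite /phi scale1r scale0r add0r subr0 mulr1.
Qed.

End LineDerivative.

Section ContinuouslyDifferentiable.
Context {R : realType} {n : nat}.
Implicit Types (U W : set 'rV[R]_n) (g h : 'rV[R]_n -> R) (x y z p v : 'rV[R]_n).

Local Notation e_ i := (delta_mx 0 i : 'rV[R]_n).

(* Strict differentiability: telescope along the coordinate path from [z] to [y]. *)
Lemma C1_strict U h p : open U -> Ck 1 U h -> U p -> forall e : R, 0 < e ->
  exists2 d : R, 0 < d & forall y z, `|y - p| < d -> `|z - p| < d ->
    `|h y - h z - \sum_i (y 0 i - z 0 i) * 'D_(e_ i) h p| <= e * `|y - z|.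
Proof.
move=> oU Ch Up e e0.
have [d1 d10 d1U] := (open_radiusP U).1 oU p Up.
(* Each of the [n] coordinate steps may cost [e / (n + 1)]; the successor keeps this share positive
   when [n = 0]. *)
have e'0 : 0 < e / n.+1%:R by rewrite divr_gt0.
have /choice[d dP] i : exists d : R, 0 < d /\ forall y, `|y - p| < d ->
    `|'D_(e_ i) h y - 'D_(e_ i) h p| < e / n.+1%:R.
  have /continuous_epsP/(_ _ e'0)[d d0 dP] := Ck_continuous (Ck_derive i Ch) Up.
  by exists d.
exists (\big[Num.min/d1]_i d i).
  by apply/bigmin_gtP; split=> // i _; case: (dP i).
move=> y z yp zp.
(* [w k] takes its first [k] coordinates from [y] and the others from [z]. Consecutive points differ
   in one coordinate, and the segment between them stays in the ball because the norm is the maximum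
   norm. *)
pose w (k : nat) : 'rV[R]_n := \row_j (if (j < k)%N then y 0 j else z 0 j).
have w0 : w 0%N = z by apply/rowP => j; rewrite mxE.
have wn : w n = y by apply/rowP => j; rewrite mxE ltn_ord.
have step (i : 'I_n) : exists2 c : R, `|c - 'D_(e_ i) h p| <= e / n.+1%:R &
    h (w i.+1) - h (w i) = (y 0 i - z 0 i) * c.
  pose s := y 0 i - z 0 i.
  have wS : w i.+1 = s *: e_ i + w i.
    apply/rowP => j; rewrite !mxE /= ltnS leq_eqVlt -val_eqE /=.
    case: eqVneq => [/val_inj ->|_] /=; last by rewrite mulr0 add0r.
    by rewrite ltnn mulr1 /s subrK.
  have near_p (t : R) : 0 <= t <= 1 -> `|t *: (s *: e_ i) + w i - p| < \big[Num.min/d1]_i d i.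
    move=> /andP[t0 t1]; apply: le_lt_trans (_ : Num.max `|y - p| `|z - p| < _); last first.
      by rewrite gt_max yp zp.
    apply: row_norm_le => [|j]; first by rewrite le_max normr_ge0.
    have yj k : `|y 0 k - p 0 k| <= Num.max `|y - p| `|z - p|.
      by rewrite le_max; have := coord_le_norm (y - p) k; rewrite !mxE => ->.
    have zj k : `|z 0 k - p 0 k| <= Num.max `|y - p| `|z - p|.
      by rewrite le_max; have := coord_le_norm (z - p) k; rewrite !mxE => ->; rewrite orbT.
    rewrite !mxE /=; case: (eqVneq j i) => [->|ji] /=; last first.
      by rewrite !mulr0 add0r; case: ifP.
    rewrite ltnn mulr1 /s.
    rewrite (_ : _ - p 0 i = t * (y 0 i - p 0 i) + (1 - t) * (z 0 i - p 0 i)); last by ring.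
    move: (yj i) (zj i); set m := Num.max _ _ => ym zm.
    apply: le_trans (ler_normD _ _) _; have t1' : 0 <= 1 - t by rewrite subr_ge0.
    by rewrite !normrM (ger0_norm t0) (ger0_norm t1'); nra.
  have derh (t : R) : 0 <= t <= 1 ->
      is_derive (t *: (s *: e_ i) + w i) (s *: e_ i) h (s * 'D_(e_ i) h (t *: (s *: e_ i) + w i)).
    move=> /near_p tp; have tU : U (t *: (s *: e_ i) + w i).
      by apply: d1U; apply: lt_le_trans tp _; exact: bigmin_le_id.
    exact: is_deriveZdir (DeriveDef (Ck_derivable i Ch tU) erefl).
  have [t tI tE] := MVT_line (fun t tI => @ex_derive _ _ _ _ _ _ _ (derh t tI)).
  exists ('D_(e_ i) h (t *: (s *: e_ i) + w i)).
    case: (dP i) => _ /(_ (t *: (s *: e_ i) + w i)) dPi; apply/ltW/dPi.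
    by apply: lt_le_trans (near_p t tI) _; exact: bigmin_le_cond.
  by rewrite wS tE; have [_ ->] := derh t tI.
have /choice[c cP] (i : 'I_n) : exists c : R, `|c - 'D_(e_ i) h p| <= e / n.+1%:R /\
    h (w i.+1) - h (w i) = (y 0 i - z 0 i) * c.
  by have [c ? ?] := step i; exists c.
rewrite -[in h y]wn -[in h z]w0 -(telescope_sumr (fun k => h (w k)) (leq0n n)) big_mkord.
rewrite -sumrB; apply: le_trans (ler_norm_sum _ _ _) _.
have bound (i : 'I_n) : `|h (w i.+1) - h (w i) - (y 0 i - z 0 i) * 'D_(e_ i) h p| <=
    `|y - z| * (e / n.+1%:R).
  have [c1 ->] := cP i; rewrite -mulrBr normrM ler_pM //.
  by have := coord_le_norm (y - z) i; rewrite !mxE.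
apply: le_trans (ler_sum _ (fun i _ => bound i)) _.
rewrite sumr_const card_ord -[leLHS]mulr_natr (mulrC e `|y - z|) -mulrA ler_wpM2l //.
by rewrite mulrAC ler_pdivrMr // ler_pM2l // ler_nat.
Qed.

(** Only the derivative of [g] along [v] is given, so strict differentiability of [h] is applied to
    the difference quotient [q] of [g]. Half of [e] pays for the strictness error, through the bound
    [c] on [q]; the other half pays for [L (q - l)], through the bound [K] on the linear form
    [L]. *)
Lemma is_derive_comp_C1 {V : normedModType R} U h (g : V -> 'rV[R]_n) (x v : V) l :
  open U -> Ck 1 U h -> U (g x) -> is_derive x v g l ->
  is_derive x v (h \o g) (\sum_i l 0 i * 'D_(e_ i) h (g x)).
Proof.
move=> oU Ch Ugx /is_derive_epsP gl; apply/is_derive_epsP => e e0.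
set L := fun u : 'rV[R]_n => \sum_i u 0 i * 'D_(e_ i) h (g x).
pose K := 1 + \sum_i `|'D_(e_ i) h (g x)|.
have K1 : 1 <= K by rewrite lerDl sumr_ge0.
have K0 : 0 < K by lra.
have LK u : `|L u| <= `|u| * K.
  apply: le_trans (ler_norm_sum _ _ _) _; rewrite mulrDr mulr1 mulr_sumr.
  rewrite ler_wpDl //; apply: ler_sum => i _; rewrite normrM ler_wpM2r //.
  exact: coord_le_norm.
pose c := 1 + `|l|; have c0 : 0 < c by rewrite /c; have := normr_ge0 l; lra.
have e2c : 0 < e / 2 / c by rewrite !divr_gt0.
have [d1 d10 strict] := C1_strict oU Ch Ugx e2c.
have [|d2 d20 gd2] := gl (Num.min 1 (e / 2 / K)).
  by rewrite lt_min ltr01 divr_gt0 // divr_gt0.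
exists (Num.min d2 (d1 / c)); first by rewrite lt_min d20 divr_gt0.
move=> t /andP[t0]; rewrite lt_min => /andP[td2 td1].
have t_neq0 : t != 0 by rewrite -normr_gt0.
pose q := t^-1 *: (g (t *: v + x) - g x).
have : `|q - l| < Num.min 1 (e / 2 / K) by apply: gd2; rewrite t0.
rewrite lt_min => /andP[q1 qe].
have qc : `|q| <= c.
  by rewrite -(subrK l q); apply: le_trans (ler_normD _ _) _; rewrite /c; lra.
have gq : g (t *: v + x) - g x = t *: q by rewrite scalerA divff // scale1r.
have gd1 : `|g (t *: v + x) - g x| < d1.
  rewrite gq normrZ; apply: le_lt_trans (_ : `|t| * c < _); first by rewrite ler_wpM2l.
  by rewrite -ltr_pdivlMr.
have := strict (g (t *: v + x)) (g x) gd1; rewrite subrr normr0 => /(_ d10).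
set E := _ - _ - _; have EE : E = h (g (t *: v + x)) - h (g x) - t * L q.
  rewrite /E /L mulr_sumr; congr (_ - _); apply: eq_bigr => i _.
  by rewrite mulrA; congr (_ * _); have /rowP/(_ i) := gq; rewrite !mxE.
rewrite {}EE gq normrZ => Ebound.
rewrite -[X in X < _]/(`|t^-1 * (h (g (t *: v + x)) - h (g x)) - L l|).
have LB : L q - L l = L (q - l).
  by rewrite /L -sumrB; apply: eq_bigr => i _; rewrite !mxE mulrBl.
rewrite (_ : _ - L l = t^-1 * (h (g (t *: v + x)) - h (g x) - t * L q) + L (q - l)); last first.
  by rewrite -LB; field.
apply: le_lt_trans (ler_normD _ _) _; rewrite [X in _ < X]splitr.
apply: ler_ltD.
  rewrite normrM normfV ler_pdivrMl // (le_trans Ebound) // mulrCA ler_wpM2l //.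
  by rewrite mulrAC ler_pdivrMr // ler_pM2l // divr_gt0.
by apply: le_lt_trans (LK _) _; rewrite -ltr_pdivlMr.
Qed.

Lemma derive_sum_partials U h x v : open U -> Ck 1 U h -> U x ->
  is_derive x v h (\sum_i v 0 i * 'D_(e_ i) h x).
Proof.
move=> oU Ch Ux.
exact: (@is_derive_comp_C1 _ U h id x v v oU Ch Ux (@is_derive_id _ _ x v)).
Qed.

End ContinuouslyDifferentiable.


Section SmoothComposition.
Context {R : realType} {n : nat}.
Implicit Types (U W : set 'rV[R]_n) (h : 'rV[R]_n -> R) (x y z p v : 'rV[R]_n).

Local Notation e_ i := (delta_mx 0 i : 'rV[R]_n).

Lemma Ck_le (k l : nat) U h : (k <= l)%N -> Ck l U h -> Ck k U h.
Proof.
move=> /subnK <-; elim: (l - k)%N => [//|m IH]; rewrite addSn => /CkW; exact: IH.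
Qed.

Lemma Ck_comp k U W (f : 'rV[R]_n -> 'rV[R]_n) h : open U -> open W ->
  (forall x, U x -> W (f x)) -> Ck k W h -> (forall j, Ck k U (fun x => f x 0 j)) ->
  Ck k U (h \o f).
Proof.
move=> oU oW fUW; elim: k h => [|k IH] h Ch Cf.
  split=> // x Ux; apply: continuous_comp; last exact: (Ck_continuous Ch (fUW x Ux)).
  by apply/continuous_rowP => j; exact: (Ck_continuous (Cf j) Ux).
have fd i x : U x -> derivable f x (e_ i).
  by move=> Ux; apply/derivable_mxP => a j; rewrite ord1; exact: (Ck_derivable i (Cf j)).
have hfd i x : U x -> is_derive x (e_ i) (h \o f)
    (\sum_j 'D_(e_ i) (fun x => f x 0 j) x * 'D_(e_ j) h (f x)).
  move=> Ux.
  have := is_derive_comp_C1 oW (Ck_le (isT : (1 <= k.+1)%N) Ch) (fUW x Ux) (DeriveDef (fd i x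
    Ux) erefl).
  by rewrite derive_mx; [under eq_bigr do rewrite mxE | exact: fd].
split=> [x Ux|i].
  apply: continuous_comp; last exact: (Ck_continuous Ch (fUW x Ux)).
  by apply/continuous_rowP => j; exact: (Ck_continuous (Cf j) Ux).
split=> [x Ux|]; first by have [] := hfd i x Ux.
apply: (Ck_eq (g := fun x => \sum_j 'D_(e_ i) (fun x => f x 0 j) x * 'D_(e_ j) h (f x))) => //.
  by move=> x Ux; have [_ ->] := hfd i x Ux.
apply: Ck_sum => // j; apply: CkM => //; first exact: Ck_derive.
by apply: IH (Ck_derive j Ch) _ => a; exact: CkW.
Qed.

(** Regularity of [f'] is asked only along [h] and only below order [k], so that the inverse and the
    exponential, whose derivatives are polynomials in themselves, go through by induction on [k]. *)
Lemma Ck_comp1 k U (f f' : R -> R) h : open U ->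
  (forall x, U x -> is_derive (h x) 1 f (f' (h x))) ->
  Ck k U h -> (forall l, (l < k)%N -> Ck l U (f' \o h)) -> Ck k U (f \o h).
Proof.
move=> oU fd; have fc x : U x -> {for h x, continuous f}.
  move=> /fd[d _]; apply: differentiable_continuous; exact/derivable1_diffP.
case: k => [|k] Ch Cf'.
  by split=> // x Ux; apply: continuous_comp (fc x Ux); exact: (Ck_continuous Ch Ux).
have hd i x : U x -> is_derive x (e_ i) (f \o h) (f' (h x) * 'D_(e_ i) h x).
  by move=> Ux; apply: is_derive_comp1 (fd x Ux) (DeriveDef (Ck_derivable i Ch Ux) erefl).
split=> [x Ux|i].
  by apply: continuous_comp (fc x Ux); exact: (Ck_continuous Ch Ux).
split=> [x Ux|]; first by have [] := hd i x Ux.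
apply: (Ck_eq (g := fun x => f' (h x) * 'D_(e_ i) h x)) => //.
  by move=> x Ux; have [_ ->] := hd i x Ux.
exact: CkM oU (Cf' k (ltnSn k)) (Ck_derive i Ch).
Qed.

Lemma is_derive_inv (t : R) : t != 0 -> is_derive t 1 (fun y : R => y^-1) (- (t^-1 * t^-1)).
Proof.
move=> t0; apply: DeriveDef; first exact: (@derivableV _ _ id).
rewrite (@deriveV _ _ id) // derive_id /GRing.scale /= mulr1.
by rewrite -expr2 exprVn.
Qed.

Lemma CkV k U h : open U -> (forall x, U x -> h x != 0) -> Ck k U h ->
  Ck k U (fun x => (h x)^-1).
Proof.
move=> oU h0; elim: k => [|k IH] Ch;
  apply: (Ck_comp1 (f' := fun t => - (t^-1 * t^-1))) => //;
  try by move=> x /h0; exact: is_derive_inv.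
move=> l; rewrite ltnS => lk; have /(Ck_le lk) Cl := IH (CkW Ch).
by apply: CkN => //; exact: CkM.
Qed.

Lemma Ck_ln k U h : open U -> (forall x, U x -> 0 < h x) -> Ck k U h ->
  Ck k U (fun x => ln (h x)).
Proof.
move=> oU h0 Ch; apply: (Ck_comp1 (f' := fun t => t^-1)) => //.
  by move=> x /h0; exact: is_derive1_ln.
move=> l /ltnW lk; apply: CkV => //; last exact: Ck_le lk Ch.
by move=> x /h0 /gt_eqF ->.
Qed.

Lemma Ck_expR k U h : open U -> Ck k U h -> Ck k U (fun x => expR (h x)).
Proof.
move=> oU; elim: k => [|k IH] Ch; apply: (Ck_comp1 (f' := expR)) => //.
by move=> l; rewrite ltnS => lk; apply: Ck_le lk (IH (CkW Ch)).
Qed.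

Lemma Ck_det k U (m : nat) (A : 'rV[R]_n -> 'M[R]_m) : open U ->
  (forall i j, Ck k U (fun x => A x i j)) -> Ck k U (fun x => \det (A x)).
Proof.
move=> oU CA; apply: Ck_sum => // s; apply: CkM => //; first exact: Ck_cst.
by apply: Ck_prod => // i; exact: CA.
Qed.

Lemma Ck_invmx k U (m : nat) (A : 'rV[R]_n -> 'M[R]_m) : open U ->
  (forall x, U x -> A x \in unitmx) ->
  (forall i j, Ck k U (fun x => A x i j)) ->
  forall i j, Ck k U (fun x => invmx (A x) i j).
Proof.
move=> oU Aunit CA i j.
apply: (Ck_eq (g := fun x => (\det (A x))^-1 * cofactor (A x) j i)) => //.
  by move=> x Ux; rewrite /invmx Aunit // !mxE.
apply: CkM => //.
  apply: CkV => //; last exact: Ck_det.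
  by move=> x /Aunit; rewrite unitmxE unitfE.
apply: CkM => //; first exact: Ck_cst.
case: m A Aunit CA i j => [|m] A Aunit CA i j; first by case: i.
apply: Ck_det => // a b.
apply: (Ck_eq (g := fun x => A x (lift j a) (lift i b))) => //.
by move=> x _; rewrite !mxE.
Qed.

Lemma linear_row_bound (N : 'M[R]_n) : exists2 K : R, 0 < K & forall v : 'rV[R]_n,
  `|v *m N| <= K * `|v|.
Proof.
exists (1 + \sum_i \sum_j `|N i j|).
  by rewrite ltr_wpDr // sumr_ge0 // => i _; rewrite sumr_ge0.
move=> v; apply: row_norm_le => [|j].
  by rewrite mulr_ge0 // addr_ge0 // sumr_ge0 // => i _; rewrite sumr_ge0.
rewrite mxE; apply: le_trans (ler_norm_sum _ _ _) _.
rewrite mulrDl mul1r ler_wpDl // mulr_suml; apply: ler_sum => i _.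
rewrite normrM mulrC ler_pM // ?coord_le_norm //.
by rewrite (bigD1 j) //= lerDl sumr_ge0.
Qed.

End SmoothComposition.


(** * The inverse function theorem *)

Section InverseFunction.
Context {R : realType} {n : nat}.
Variables (U : set 'rV[R]_n) (f : 'rV[R]_n -> 'rV[R]_n) (p : 'rV[R]_n).
Hypotheses (oU : open U) (Up : U p) (fsmooth : smooth_on U f).

Local Notation e_ i := (delta_mx 0 i : 'rV[R]_n).

Definition jac (x : 'rV[R]_n) : 'M[R]_n :=
  \matrix_(i, j) 'D_(e_ i) (fun y => f y 0 j) x.

Lemma smooth_coord k j : Ck k U (fun x => f x 0 j).
Proof. by have /class_CP := fsmooth k; apply. Qed.

Lemma Ck_jac k i j : Ck k U (fun x => jac x i j).
Proof.
apply: (Ck_eq (g := fun x => 'D_(e_ i) (fun y => f y 0 j) x)) => //.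
  by move=> x _; rewrite mxE.
exact/Ck_derive/smooth_coord.
Qed.

Lemma jac_strict x : U x -> forall e : R, 0 < e ->
  exists2 d : R, 0 < d & forall y z, `|y - x| < d -> `|z - x| < d ->
    `|f y - f z - (y - z) *m jac x| <= e * `|y - z|.
Proof.
move=> Ux e e0.
have /choice[d dP] j : exists d : R, 0 < d /\ forall y z, `|y - x| < d -> `|z - x| < d ->
    `|f y 0 j - f z 0 j - \sum_i (y 0 i - z 0 i) * 'D_(e_ i) (fun y => f y 0 j) x|
      <= e * `|y - z|.
  by have [d d0 dP] := C1_strict oU (smooth_coord 1 j) Ux e0; exists d.
exists (\big[Num.min/1]_j d j); first by apply/bigmin_gtP; split=> // j _; case: (dP j).
move=> y z yx zx; apply: row_norm_le => [|j]; first by rewrite mulr_ge0 // ltW.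
have [_] := dP j => /(_ y z); rewrite !mxE.
rewrite (eq_bigr (fun i => (y - z) 0 i * jac x i j)); last by move=> i _; rewrite !mxE.
by apply; [apply: lt_le_trans yx _|apply: lt_le_trans zx _]; exact: bigmin_le_cond.
Qed.

Lemma jac_derive x v : U x -> is_derive x v f (v *m jac x).
Proof.
move=> Ux.
have fd j : is_derive x v (fun y => f y 0 j) (\sum_i v 0 i * 'D_(e_ i) (fun y => f y 0 j) x).
  exact: derive_sum_partials oU (smooth_coord 1 j) Ux.
have fdv : derivable f x v by apply/derivable_mxP => a j; rewrite ord1; case: (fd j).
apply: DeriveDef => //; rewrite derive_mx //; apply/rowP => j; rewrite !mxE.
by have [_ ->] := fd j; apply: eq_bigr => i _; rewrite mxE.
Qed.

Hypothesis unit_jac : jac p \in unitmx.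

(** After multiplication by the inverse Jacobian at [p], the map [H] differs from the identity by a
    map with Lipschitz constant 1/2 near [p]; hence injectivity and a Lipschitz inverse. Smoothness
    of [g] is a bootstrap: its partial derivatives are entries of [invmx (jac (g y))], as regular as
    [g] itself. *)
Lemma inverse_function : exists (W V : set 'rV[R]_n) (g : 'rV[R]_n -> 'rV[R]_n),
  [/\ W p, W `<=` U & local_diffeo_with_inverse W V f g].
Proof.
have [d0 d00 d0U] : exists2 d : R, 0 < d & forall x, `|x - p| < d -> U x /\ jac x \in unitmx.
  have [d1 d10 d1U] := (open_radiusP U).1 oU p Up.
  have dp : 0 < `|\det (jac p)| by rewrite normr_gt0 -unitfE -unitmxE.
  have /continuous_epsP/(_ _ dp)[d2 d20 d2P] := Ck_continuous (Ck_det oU (Ck_jac 0)) Up.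
  exists (Num.min d1 d2); first by rewrite lt_min d10.
  move=> x; rewrite lt_min => /andP[x1 x2]; split; first exact: d1U.
  rewrite unitmxE unitfE; apply: contraTneq (d2P x x2) => ->.
  by rewrite sub0r normrN ltxx.
pose N := invmx (jac p); have [K K0 KP] := linear_row_bound N.
have [|d1 d10 d1P] := @jac_strict p Up (K^-1 / 2); first by rewrite divr_gt0 // invr_gt0.
pose d := Num.min d0 d1; have dgt0 : 0 < d by rewrite lt_min d00.
pose H x := f x *m N.
have Hhalf y z : `|y - p| < d -> `|z - p| < d -> `|H y - H z - (y - z)| <= `|y - z| / 2.
  rewrite !lt_min => /andP[_ yd] /andP[_ zd]; have := d1P y z yd zd.
  rewrite -(ler_pM2l K0) => h.
  rewrite (_ : _ - (y - z) = (f y - f z - (y - z) *m jac p) *m N); last first.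
    by rewrite !mulmxBl /H -!mulmxA mulmxV // !mulmx1 -!mulmxBl.
  apply: le_trans (KP _) (le_trans h _).
  by rewrite !mulrA divff ?gt_eqF // mul1r mulrC.
have Hexp y z : `|y - p| < d -> `|z - p| < d -> `|y - z| <= 2 * `|H y - H z|.
  move=> yd zd; have := Hhalf y z yd zd; rewrite -[_ - (y - z)]opprB normrN opprB => h.
  have := ler_normD (y - z - (H y - H z)) (H y - H z); rewrite subrK.
  by move: h; rewrite opprB; lra.
pose r := d / 2; have r0 : 0 < r by rewrite divr_gt0.
have rd : r < d by rewrite /r; lra.
(* The factor 1/8 leaves room: the minimizer and the corrected point used below lie within 4 and 5
   times [|c - H p|] of [p], hence inside the ball of radius [r]. *)
pose W := [set x | `|x - p| < r /\ `|H x - H p| < r / 8].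
pose V := [set y : 'rV[R]_n | `|y *m N - H p| < r / 8].
have Wd x : W x -> `|x - p| < d by move=> [xr _]; apply: lt_trans rd.
have Hcont x : `|x - p| < d -> {for x, continuous H}.
  move=> xd; apply/continuous_epsP => e e0.
  exists (Num.min (d - `|x - p|) (e / 2)); first by rewrite lt_min subr_gt0 xd divr_gt0.
  move=> y; rewrite lt_min => /andP[y1 y2].
  have yd : `|y - p| < d.
    have := ler_normD (y - x) (x - p); rewrite addrA subrK; lra.
  have := ler_normD (H y - H x - (y - x)) (y - x); rewrite subrK.
  have := Hhalf y x yd xd; lra.
(* On the closed ball of radius [r] about [p], the minimum of [|H x - c|] is zero: since [H] is
   close to the identity, the step [x0 + (c - H x0)] would halve it. *)
have surj y : V y -> exists x, W x /\ f x = y.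
  rewrite /V /=; set c := y *m N => cV.
  pose B := [set x : 'rV[R]_n | forall j, [set` `[p 0 j - r, p 0 j + r]] (x ord0 j)].
  have BP x : B x <-> `|x - p| <= r.
    split=> [Bx|xr j].
      apply: row_norm_le => [|j]; first exact: ltW.
      by have := Bx j; rewrite !mxE /= in_itv /= => /andP[]; rewrite ler_norml; lra.
    have := le_trans (coord_le_norm (x - p) j) xr.
    by rewrite !mxE /= in_itv /= ler_norml => /andP[]; lra.
  have Bcompact : compact B by apply: (@rV_compact R n (fun j => [set` `[p 0 j - r, p 0 j +
    r]])) => j; exact: segment_compact.
  have Bcont : {within B, continuous (fun x => `|H x - c|)}.
    apply: continuous_in_subspaceT => x; rewrite inE => /BP xr.
    apply/continuous_epsP => e e0.
    have /continuous_epsP/(_ e e0)[d2 d20 d2P] := Hcont x (le_lt_trans xr rd).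
    exists d2 => // z /d2P; apply: le_lt_trans; apply: le_trans (ler_dist_dist _ _) _.
    by rewrite opprB addrA subrK.
  have [|x0 x0B x0min] := @EVT_min_rV R n _ B _ Bcompact Bcont.
    by exists p; apply/BP; rewrite subrr normr0 ltW.
  move: x0B; rewrite inE => /BP x0r.
  have x0d : `|x0 - p| < d by apply: le_lt_trans rd.
  have pd : `|p - p| < d by rewrite subrr normr0.
  have minp : `|H x0 - c| <= `|H p - c|.
    by apply: x0min; rewrite inE; apply/BP; rewrite subrr normr0 ltW.
  have x0p : `|x0 - p| <= 4 * `|c - H p|.
    have := Hexp x0 p x0d pd; have := ler_normD (H x0 - c) (c - H p).
    by rewrite addrA subrK; move: minp; rewrite (distrC (H p)); lra.
  pose x1 := x0 + (c - H x0).
  have x1p : `|x1 - p| <= 5 * `|c - H p|.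
    have := ler_normD (x0 - p) (c - H x0); rewrite (distrC c (H x0)).
    by rewrite (_ : _ + (c - H x0) = x1 - p) ?(distrC c) /x1 1?addrAC //; move: minp x0p;
      rewrite (distrC c); lra.
  have x1r : `|x1 - p| <= r by apply: le_trans x1p _; lra.
  have := x0min x1; rewrite inE => /(_ ((BP x1).2 x1r)).
  have := Hhalf x1 x0 (le_lt_trans x1r rd) x0d.
  have x10 : x1 - x0 = c - H x0 by rewrite /x1 addrC addKr.
  rewrite x10 (_ : H x1 - H x0 - (c - H x0) = H x1 - c); last first.
    by rewrite opprB addrA subrK.
  rewrite (distrC c) => h1 h2.
  have Hx0 : H x0 = c.
    apply/eqP; rewrite -subr_eq0 -normr_le0; lra.
  exists x0; split; first by split; [lra | rewrite Hx0].
  by move: Hx0; rewrite /H /c => /(can_inj (mulmxKV unit_jac)).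
have inj x y : `|x - p| < d -> `|y - p| < d -> f x = f y -> x = y.
  move=> xd yd fxy; apply/eqP; rewrite -subr_eq0 -normr_le0.
  by have := Hexp x y xd yd; rewrite /H fxy subrr normr0 mulr0.
pose g y := xget p [set x | W x /\ f x = y].
have gP y : V y -> W (g y) /\ f (g y) = y.
  by move=> /surj[x xP]; rewrite /g; case: xgetP => [_ -> //|/(_ x)].
have fV x : W x -> V (f x) by case.
have fK x : W x -> g (f x) = x.
  move=> Wx; have [Wg fg] := gP _ (fV x Wx).
  by apply: inj fg; exact: Wd.
have oW : open W.
  apply/open_radiusP => x Wx; have [xr xH] := Wx.
  have r8 : 0 < r / 8 - `|H x - H p| by rewrite subr_gt0.
  have /continuous_epsP/(_ _ r8)[d2 d20 d2P] := Hcont x (Wd x Wx).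
  exists (Num.min d2 (r - `|x - p|)); first by rewrite lt_min d20 subr_gt0.
  move=> y; rewrite lt_min => /andP[/d2P y1 y2]; split.
    by have := ler_normD (y - x) (x - p); rewrite addrA subrK; lra.
  by have := ler_normD (H y - H x) (H x - H p); rewrite addrA subrK; lra.
have oV : open V.
  apply/open_radiusP => y; rewrite /V /= => yV.
  exists ((r / 8 - `|y *m N - H p|) / K); first by rewrite divr_gt0 // subr_gt0.
  move=> z; rewrite ltr_pdivlMr // => zy.
  have := ler_normD (z *m N - y *m N) (y *m N - H p); rewrite addrA subrK.
  by have := KP (z - y); rewrite mulmxBl mulrC; lra.
have glip y z : V y -> V z -> `|g y - g z| <= 2 * K * `|y - z|.
  move=> Vy Vz; have [Wy fy] := gP y Vy; have [Wz fz] := gP z Vz.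
  have := Hexp _ _ (Wd _ Wy) (Wd _ Wz); rewrite /H fy fz -mulmxBl.
  by have := KP (y - z); lra.
have gcont y : V y -> {for y, continuous g}.
  move=> Vy; apply/continuous_epsP => e e0; have [d2 d20 d2V] := (open_radiusP V).1 oV y Vy.
  exists (Num.min d2 (e / (2 * K))); first by rewrite lt_min d20 divr_gt0 // mulr_gt0.
  move=> z; rewrite lt_min ltr_pdivlMr ?mulr_gt0 // => /andP[/d2V Vz zy].
  by apply: le_lt_trans (glip z y Vz Vy) _; rewrite mulrC.
have WU : W `<=` U by move=> x /Wd; rewrite lt_min => /andP[/d0U[]].
have Wunit x : W x -> jac x \in unitmx by move=> /Wd; rewrite lt_min => /andP[/d0U[]].
have gderive y v : V y -> is_derive y v g (v *m invmx (jac (g y))).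
  move=> Vy; have [Wg fg] := gP y Vy; apply/is_derive_epsP => e e0.
  have [Kx Kx0 KxP] := linear_row_bound (invmx (jac (g y))).
  (* [2 K] is the Lipschitz constant of [g] and [Kx] bounds the inverse Jacobian at [g y]; the
     summand 1 makes the final inequality strict. *)
  pose c := 1 + Kx * (2 * K * `|v|).
  have c0 : 0 < c by rewrite ltr_wpDr // !mulr_ge0 // ltW.
  have [|d2 d20 d2P] := jac_strict (WU _ Wg) (_ : 0 < e / c); first by rewrite divr_gt0.
  have [d3 d30 d3V] := (open_radiusP V).1 oV y Vy.
  have v1 : 0 < 1 + `|v| by rewrite ltr_wpDr.
  have m0 : 0 < Num.min d3 (d2 / (2 * K)) by rewrite lt_min d30 divr_gt0 // mulr_gt0.
  exists (Num.min d3 (d2 / (2 * K)) / (1 + `|v|)); first by rewrite divr_gt0.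
  move=> t /andP[t0]; rewrite ltr_pdivlMr // => td.
  have tvlt : `|t *: v + y - y| < Num.min d3 (d2 / (2 * K)).
    rewrite addrK normrZ; apply: le_lt_trans td; rewrite ler_wpM2l //; lra.
  move: (tvlt); rewrite lt_min => /andP[/d3V Vt tv2].
  have [Wt ft] := gP _ Vt.
  pose w := g (t *: v + y) - g y.
  have wlip : `|w| <= 2 * K * (`|t| * `|v|).
    by rewrite -normrZ -[t *: v](addrK y); exact: glip.
  have wd : `|w| < d2.
    apply: le_lt_trans (glip _ _ Vt Vy) _.
    by rewrite mulrC -ltr_pdivlMr // mulr_gt0.
  have gg0 : `|g y - g y| < d2 by rewrite subrr normr0.
  have := d2P (g (t *: v + y)) (g y) wd gg0; rewrite ft fg addrK -/w => strict.
  have tn0 : t != 0 by rewrite -normr_gt0.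
  rewrite (_ : t^-1 *: w - _ = - (t^-1 *: ((t *: v - w *m jac (g y)) *m invmx (jac (g y)))));
    last first.
    rewrite mulmxBl mulmxK ?Wunit // (scalerBr t^-1 _ w) -scalemxAl scalerA mulVf // scale1r.
    by rewrite opprB.
  rewrite normrN normrZ normfV ltr_pdivrMl //.
  apply: le_lt_trans (KxP _) _.
  have step1 : Kx * `|t *: v - w *m jac (g y)| <= Kx * (e / c * (2 * K * (`|t| * `|v|))).
    rewrite ler_pM2l //; apply: le_trans strict _; rewrite ler_wpM2l //.
    by rewrite ltW // divr_gt0.
  apply: le_lt_trans step1 _.
  rewrite [ltLHS](_ : _ = `|t| * (e * ((Kx * (2 * K * `|v|)) / c)));
    last by move: (c^-1) => ci; ring.
  rewrite ltr_pM2l // gtr_pMr // ltr_pdivrMr // mul1r /c; lra.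
have gsmooth k j : Ck k V (fun y => g y 0 j).
  elim: k j => [|k IH] j.
    by split=> // y Vy; have /continuous_rowP := gcont y Vy.
  split=> [y Vy|i]; first by have /continuous_rowP := gcont y Vy.
  split=> [y Vy|].
    by have [/derivable_mxP + _] := gderive y (e_ i) Vy; exact.
  apply: (Ck_eq (g := (fun x => invmx (jac x) i j) \o g)) => //.
    move=> y Vy; have [dg dE] := gderive y (e_ i) Vy.
    by have := derive_mx dg; rewrite dE -rowE => /rowP/(_ j); rewrite !mxE.
  apply: (Ck_comp oV oW) => //; first by move=> y /gP[].
  apply: Ck_invmx => // a b; exact: Ck_sub (Ck_jac k a b).
exists W, V, g; split=> //.
  by split; rewrite subrr normr0 //; lra.
split=> //.
- by move=> k; apply/class_CP => // j; apply: Ck_sub (smooth_coord k j).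
- by move=> k; apply/class_CP.
- by move=> x Wx; split; [exact: fV|exact: fK].
Qed.

End InverseFunction.


(** * The logarithmic model *)

Section LogarithmicModel.
Context {R : realType} {n : nat}.
Implicit Types (A B H : 'M[R]_n.+1) (x v : 'rV[R]_n) (a b c : 'I_n.+1).

Local Notation e_ i := (delta_mx 0 i : 'rV[R]_n).

Definition log_sum (a : nat) x : R := \sum_(i < n) (i < a)%:R * x 0 i.

(** This is [- (A z)_a / z_a], the derivative of [log z_a] along [z |-> - A z]. The minus sign makes
    the passage from matrices to fields a homomorphism, not an antihomomorphism, for
    [lie_bracket]. *)
Definition log_component A a x : R :=
  - \sum_b A a b * expR (log_sum b x - log_sum a x).

(* The linear field [z |-> - A z] on the positive orthant of [R^(n+1)], modulo scaling, in the
   coordinates [x_k = log z_k - log z_(k-1)], so that [log_sum a x = log z_a - log z_0]. *)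
Definition log_field A x : 'rV[R]_n :=
  \row_k (log_component A (lift ord0 k) x - log_component A (widen_ord (leqnSn n) k) x).

Lemma log_sum0 x : log_sum 0 x = 0.
Proof. by apply: big1 => i _; rewrite ltn0 mul0r. Qed.

Lemma log_sumS x (i : 'I_n) : log_sum i.+1 x = log_sum i x + x 0 i.
Proof.
transitivity (\sum_(j < n) ((j < i)%:R * x 0 j + (j == i)%:R * x 0 j)).
  apply: eq_bigr => j _; rewrite -mulrDl -natrD ltnS leq_eqVlt -val_eqE /= addnC.
  by case: eqVneq => [->|]; rewrite ?ltnn ?add0n // orFb.
rewrite big_split /=; congr (_ + _); rewrite (bigD1 i) //= eqxx mul1r big1 ?addr0 //.
by move=> j /negPf ->; rewrite mul0r.
Qed.

Lemma log_sum_telescope (L : 'I_n.+1 -> R) a :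
  log_sum a (\row_k (L (lift ord0 k) - L (widen_ord (leqnSn n) k))) = L a - L ord0.
Proof.
case: a => m /= mn; elim: m mn => [|m IH] mn.
  by rewrite log_sum0 (_ : Ordinal mn = ord0) ?subrr //; apply: val_inj.
have mn' : (m < n)%N by [].
rewrite -[m]/(val (Ordinal mn')) log_sumS /= IH ?(ltnW mn) // => mn''.
rewrite mxE (_ : lift ord0 _ = Ordinal mn); last exact: val_inj.
rewrite (_ : widen_ord _ _ = Ordinal mn''); last exact: val_inj.
ring.
Qed.

Lemma log_sum_field A a x :
  log_sum a (log_field A x) = log_component A a x - log_component A ord0 x.
Proof. exact: (log_sum_telescope (fun b => log_component A b x)). Qed.

Lemma Ck_log_component k A a : Ck k setT (log_component A a).
Proof.
have oT := @openT 'rV[R]_n.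
have Cs m : Ck k setT (@log_sum m).
  by apply: Ck_sum => // i; apply: CkM => //; [exact: Ck_cst | exact: Ck_coord].
apply: CkN => //; apply: Ck_sum => // b; apply: CkM => //; first exact: Ck_cst.
by apply: Ck_expR => //; exact: CkB.
Qed.

Lemma log_field_smooth A : smooth_on setT (log_field A).
Proof.
move=> k; have oT := @openT 'rV[R]_n; apply/class_CP => // j.
apply: (Ck_eq (g := fun x => log_component A (lift ord0 j) x -
                   log_component A (widen_ord (leqnSn n) j) x)) => //.
  by move=> x _; rewrite mxE.
by apply: CkB => //; exact: Ck_log_component.
Qed.

Lemma is_derive_sum_pointwise m (f : 'I_m -> 'rV[R]_n -> R) x v (l : 'I_m -> R) :
  (forall i, is_derive x v (f i) (l i)) ->
  is_derive x v (fun y => \sum_i f i y) (\sum_i l i).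
Proof.
move=> fl; rewrite (_ : (fun y => \sum_i f i y) = \sum_i f i); first exact: is_derive_sum.
by apply/funext => y; rewrite fct_sumE.
Qed.

Lemma is_derive_log_sum a x v : is_derive x v (log_sum a) (log_sum a v).
Proof.
apply: is_derive_sum_pointwise => i.
exact: (@is_deriveZ _ _ _ (fun y : 'rV[R]_n => y 0 i) (i < a)%:R x v _ (is_derive_coord x v i)).
Qed.

Lemma is_derive_log_component A a x v : is_derive x v (log_component A a)
  (- \sum_b A a b * (expR (log_sum b x - log_sum a x) * (log_sum b v - log_sum a v))).
Proof.
apply: (is_deriveN (f := fun y => \sum_b A a b * expR (log_sum b y - log_sum a y))).
apply: is_derive_sum_pointwise => b.
apply: (@is_deriveZ _ _ _ (fun y => expR (log_sum b y - log_sum a y)) (A a b)).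
apply: (is_derive_comp1 (f := expR) (g := fun y => log_sum b y - log_sum a y)).
exact: (is_deriveB (is_derive_log_sum b x v) (is_derive_log_sum a x v)).
Qed.

Lemma log_component_linear (s : R) A B a x :
  log_component (s *: A + B) a x = s * log_component A a x + log_component B a x.
Proof.
rewrite /log_component mulrN -opprD mulr_sumr -big_split /=; congr (- _).
by apply: eq_bigr => b _; rewrite !mxE mulrDl mulrA.
Qed.

(** The quotient rule for [- (B z)_a / z_a] along [- A z]. The product term is symmetric in [A] and
    [B], so it cancels in the bracket and leaves the component of [A B - B A]. *)
Lemma log_component_derive A B a x :
  'D_(log_field A x) (log_component B a) x =
  - log_component (B *m A) a x - log_component A a x * log_component B a x.
Proof.
have [_ ->] := is_derive_log_component B a x (log_field A x).
pose E b := B a b * expR (log_sum b x - log_sum a x).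
have -> : \sum_b B a b * (expR (log_sum b x - log_sum a x) *
      (log_sum b (log_field A x) - log_sum a (log_field A x))) =
    \sum_b E b * log_component A b x - log_component A a x * \sum_b E b.
  rewrite mulr_sumr -sumrB; apply: eq_bigr => b _; rewrite !log_sum_field /E; ring.
rewrite opprB addrC; congr (_ + _); last by rewrite [log_component B a x]/log_component mulrN opprK.
rewrite [log_component (B *m A) a x]/log_component opprK -sumrN.
transitivity (\sum_b \sum_c B a b * A b c * expR (log_sum c x - log_sum a x)).
  apply: eq_bigr => b _; rewrite /log_component mulrN opprK mulr_sumr.
  apply: eq_bigr => c _; rewrite /E.
  rewrite (_ : log_sum c x - log_sum a x = (log_sum b x - log_sum a x) +
    (log_sum c x - log_sum b x)); last by ring.
  by rewrite (expRD (log_sum b x - log_sum a x)); ring.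
rewrite exchange_big; apply: eq_bigr => c _ /=.
by rewrite mxE mulr_suml.
Qed.

Lemma derive_log_field A B x : 'D_(log_field A x) (log_field B) x =
  \row_k ((- log_component (B *m A) (lift ord0 k) x -
             log_component A (lift ord0 k) x * log_component B (lift ord0 k) x) -
          (- log_component (B *m A) (widen_ord (leqnSn n) k) x -
             log_component A (widen_ord (leqnSn n) k) x *
             log_component B (widen_ord (leqnSn n) k) x)).
Proof.
have dc a : is_derive x (log_field A x) (log_component B a)
    ('D_(log_field A x) (log_component B a) x).
  by have [dd _] := is_derive_log_component B a x (log_field A x); exact: DeriveDef.
have d k : is_derive x (log_field A x) (fun y => log_field B y 0 k)
  ('D_(log_field A x) (log_component B (lift ord0 k)) x -
   'D_(log_field A x) (log_component B (widen_ord (leqnSn n) k)) x).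
  rewrite (_ : (fun y => _) = log_component B (lift ord0 k) -
    log_component B (widen_ord (leqnSn n) k)); last first.
    by apply/funext => y; rewrite mxE.
  exact: is_deriveB (dc _) (dc _).
rewrite derive_mx; last by apply/derivable_mxP => i k; rewrite ord1; case: (d k).
by apply/rowP => k; rewrite !mxE; have [_ ->] := d k; rewrite !log_component_derive.
Qed.

Lemma log_field_realization : realization setT log_field.
Proof.
split=> [A _|s A B x _ _ _|A B x _ _ _].
- exact: log_field_smooth.
- by apply/rowP => k; rewrite !mxE !log_component_linear; ring.
- rewrite /lie_bracket !derive_log_field; apply/rowP => k; rewrite !mxE.
  by rewrite -[A *m B - B *m A]addrC -scaleN1r !log_component_linear; ring.
Qed.

Lemma log_component_delta (s : R) a b c x :
  log_component (s *: delta_mx a b) c x =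
  - (c == a)%:R * s * expR (log_sum b x - log_sum a x).
Proof.
rewrite /log_component (bigD1 b) //= big1 => [|d /negPf db].
  by rewrite !mxE eqxx andbT addr0; case: eqVneq => [->|];
    rewrite /= ?mulr1 ?mul1r ?mulr0 ?mul0r ?oppr0 ?mul0r //; ring.
by rewrite !mxE db andbF mulr0 mul0r.
Qed.

Lemma root_vector_delta (al : 'M[R]_n.+1 -> R) (s : R) a b : a != b -> s != 0 ->
  (forall H, al H = H a a - H b b) -> root_vector al (s *: delta_mx a b).
Proof.
move=> ab s0 alE; split.
- rewrite /sl /= mxtraceZ /mxtrace big1 ?mulr0 // => i _; rewrite mxE.
  by case: eqVneq => //= ->; rewrite (negPf ab).
- apply: contra_neq s0 => /matrixP/(_ a b); rewrite !mxE !eqxx mulr1; exact.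
move=> H _ /is_diag_mxP Hd; rewrite -scalemxAl -scalemxAr -scalerBr scalerA mulrC -scalerA.
congr (s *: _); apply/matrixP => i j; rewrite alE !mxE.
rewrite (bigD1 a) //= [X in _ - X](bigD1 b) //= !big1 => [|k /negPf kb|k /negPf ka].
- rewrite !mxE !eqxx /= andbT !addr0.
  case: (eqVneq i a) => [->|ia]; case: (eqVneq j b) => [->|jb] /=;
    rewrite ?mulr1 ?mulr0 ?mul1r ?mul0r ?subr0 ?sub0r //.
  + by rewrite Hd ?oppr0 // eq_sym.
  + by rewrite Hd.
- by rewrite !mxE kb andbF mul0r.
- by rewrite !mxE ka mulr0.
Qed.

Lemma log_field_given_by : given_by log_field X1_pos X1_neg.
Proof.
move=> i; pose a := widen_ord (leqnSn n) i; pose b := lift ord0 i.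
have ab : a != b by rewrite -val_eqE /= /bump /= add1n neq_ltn ltnSn.
have bi x : log_sum b x - log_sum a x = x 0 i.
  by rewrite (_ : val b = i.+1) // log_sumS addrAC subrr add0r.
split.
- exists (1 *: delta_mx a b); first exact: root_vector_delta.
  apply/funext => x; apply/rowP => k; rewrite !mxE !log_component_delta bi.
  by rewrite -!val_eqE /= /bump /= !add1n; ring.
- exists (- 1 *: delta_mx b a).
    by apply: root_vector_delta; rewrite ?oppr_eq0 ?oner_eq0 1?eq_sym // => H; rewrite opprB.
  apply/funext => x; apply/rowP => k; rewrite !mxE !log_component_delta.
  rewrite (_ : log_sum a x - log_sum b x = - x 0 i); last by rewrite -bi opprB.
  by rewrite -!val_eqE /= /bump /= !add1n; ring.
Qed.

End LogarithmicModel.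


(** * Realizations and their fixed points *)

Section SpecialLinearAlgebra.
Context {R : realType} {n : nat}.
Implicit Types (A B : 'M[R]_n.+1) (a b c : 'I_n.+1).

Definition linear_on_sl (phi : 'M[R]_n.+1 -> R) :=
  forall (s : R) A B, sl R n A -> sl R n B -> phi (s *: A + B) = s * phi A + phi B.

(** The traceless part of an elementary matrix; these span [sl]. *)
Definition unit0 a b : 'M[R]_n.+1 := delta_mx a b - ((a == b)%:R / n.+1%:R)%:M.

(* The traceless matrix representing a functional on [sl] through the trace form. *)
Definition trace_dual (phi : 'M[R]_n.+1 -> R) : 'M[R]_n.+1 :=
  \matrix_(b, a) phi (unit0 a b).

Lemma mxtrace_delta a b : \tr (delta_mx a b : 'M[R]_n.+1) = (a == b)%:R.
Proof.
rewrite /mxtrace (bigD1 a) //= mxE eqxx /= big1 ?addr0 // => i /negPf ia.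
by rewrite mxE ia.
Qed.

Lemma sl_unit0 a b : sl R n (unit0 a b).
Proof.
rewrite /sl /= raddfB /= mxtrace_delta mxtrace_scalar -[X in _ - X]mulr_natr divfK ?subrr //
  pnatr_eq0.
Qed.

Lemma sl_bracket A B : sl R n (A *m B - B *m A).
Proof. by rewrite /sl /= raddfB /= mxtrace_mulC subrr. Qed.

Lemma slD (s : R) A B : sl R n A -> sl R n B -> sl R n (s *: A + B).
Proof. by rewrite /sl /= => A0 B0; rewrite mxtraceD mxtraceZ A0 B0 mulr0 addr0. Qed.

Lemma sl0 : sl R n 0.
Proof. by rewrite /sl /= mxtrace0. Qed.

Lemma linear_on_sl0 phi : linear_on_sl phi -> phi 0 = 0.
Proof.
move=> lphi; have := lphi 1 0 0 sl0 sl0; rewrite scaler0 addr0 mul1r.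
by move=> h; apply: (addrI (phi 0)); rewrite addr0 -h.
Qed.

Lemma linear_on_sl_sum (I : Type) (r : seq I) (P : pred I) phi (s : I -> R)
    (A : I -> 'M[R]_n.+1) : linear_on_sl phi -> (forall i, sl R n (A i)) ->
  phi (\sum_(i <- r | P i) s i *: A i) = \sum_(i <- r | P i) s i * phi (A i).
Proof.
move=> lphi A0.
suff [//] : phi (\sum_(i <- r | P i) s i *: A i) = \sum_(i <- r | P i) s i * phi (A i) /\
  sl R n (\sum_(i <- r | P i) s i *: A i).
elim: r => [|i r [IH1 IH2]]; first by rewrite !big_nil linear_on_sl0 //; split=> //; exact: sl0.
rewrite !big_cons; case: (P i) => //.
by rewrite lphi // IH1; split=> //; exact: slD.
Qed.

Lemma sum_unit0 A : sl R n A -> A = \sum_a \sum_b A a b *: unit0 a b.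
Proof.
move=> A0; rewrite [LHS]matrix_sum_delta.
under [RHS]eq_bigr => a _ do under eq_bigr => b _ do rewrite scalerBr.
under [RHS]eq_bigr => a _ do rewrite sumrB.
rewrite sumrB [X in _ - X](_ : _ = 0) ?subr0 //.
transitivity ((\tr A / n.+1%:R)%:M : 'M[R]_n.+1); last by rewrite A0 mul0r raddf0.
rewrite /mxtrace mulr_suml raddf_sum; apply: eq_bigr => a _ /=.
rewrite (bigD1 a) //= eqxx mul1r scale_scalar_mx big1 ?addr0 // => b /negPf ab.
by rewrite eq_sym ab mul0r raddf0 scaler0.
Qed.

Lemma trace_dualE phi A : linear_on_sl phi -> sl R n A -> phi A = \tr (A *m trace_dual phi).
Proof.
move=> lphi A0; rewrite {1}(sum_unit0 A0) pair_bigA /=.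
rewrite (linear_on_sl_sum _ _ _ lphi) => [|ab]; last exact: sl_unit0.
rewrite -(pair_bigA _ (fun a b => A a b * phi (unit0 a b))) /=.
by apply: eq_bigr => a _; rewrite mxE; apply: eq_bigr => b _; rewrite mxE.
Qed.

Lemma trace_dual_traceless phi : linear_on_sl phi -> \tr (trace_dual phi) = 0.
Proof.
move=> lphi; rewrite -(linear_on_sl0 lphi).
have -> : 0 = \sum_a 1 *: unit0 a a :> 'M[R]_n.+1.
  under eq_bigr do rewrite scale1r; rewrite sumrB -raddf_sum /=.
  apply/esym/eqP; rewrite subr_eq0; apply/eqP/matrixP => i j.
  rewrite summxE (bigD1 i) //= big1 => [|k /negPf ki]; last by rewrite mxE eq_sym ki.
  rewrite !mxE eqxx addr0 (eq_bigr (fun=> (n.+1%:R)^-1)) => [|k _]; last by rewrite eqxx mul1r.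
  by rewrite sumr_const card_ord -[_ *+ n.+1]mulr_natr mulVf ?pnatr_eq0 // eq_sym.
rewrite (linear_on_sl_sum _ _ _ lphi) => [|a]; last exact: sl_unit0.
by apply: eq_bigr => a _; rewrite mxE mul1r.
Qed.

Lemma unit0_offdiag a b : a != b -> unit0 a b = unit0 a a *m unit0 a b - unit0 a b *m unit0 a a.
Proof.
move=> ab; rewrite /unit0 eqxx (negPf ab) mul0r raddf0 subr0 mulmxBl mulmxBr.
by rewrite mul_delta_mx mul_delta_mx_0 1?eq_sym // scalar_mxC sub0r opprK subrK.
Qed.

(** Summing [E_aa - E_bb] over [b] gives [(n + 1) E_aa - 1]. Together with [unit0_offdiag] this
    writes generators of [sl] as explicit combinations of brackets with total weight at most one,
    which serves both perfectness and the estimate near a fixed point. *)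
Lemma unit0_diag a : unit0 a a =
  \sum_(b | b != a) n.+1%:R^-1 *: (unit0 a b *m unit0 b a - unit0 b a *m unit0 a b).
Proof.
transitivity (\sum_(b | b != a) n.+1%:R^-1 *: (delta_mx a a - delta_mx b b : 'M[R]_n.+1)).
  rewrite -scaler_sumr /unit0 eqxx mul1r.
  have -> : \sum_(b | b != a) (delta_mx a a - delta_mx b b : 'M[R]_n.+1) =
    \sum_b (delta_mx a a - delta_mx b b : 'M[R]_n.+1).
    by rewrite [RHS](bigD1 a) //= subrr add0r.
  rewrite sumrB sumr_const card_ord scalerBr -[delta_mx a a *+ _]scaler_nat scalerA mulVf
    ?pnatr_eq0 // scale1r.
  congr (_ - _); rewrite -scalemx1; congr (_ *: _).
  apply/matrixP => i j; rewrite summxE (bigD1 i) //= big1 => [|k /negPf ki].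
    by rewrite !mxE eqxx addr0 eq_sym.
  by rewrite mxE eq_sym ki.
apply: eq_bigr => b /negPf ba; congr (_ *: _).
by rewrite /unit0 ba eq_sym ba mul0r raddf0 !subr0 !mul_delta_mx.
Qed.

Lemma perfect_sl phi : linear_on_sl phi ->
  (forall A B, sl R n A -> sl R n B -> phi (A *m B - B *m A) = 0) ->
  forall A, sl R n A -> phi A = 0.
Proof.
move=> lphi phi0 A A0; rewrite (trace_dualE lphi A0) [trace_dual phi](_ : _ = 0) ?mulmx0
  ?mxtrace0 //.
apply/matrixP => b a; rewrite !mxE; case: (eqVneq a b) => [<-|ab].
  rewrite unit0_diag (linear_on_sl_sum _ _ _ lphi) => [|c]; last exact: sl_bracket.
  by rewrite big1 // => c _; rewrite phi0 ?mulr0 //; exact: sl_unit0.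
by rewrite unit0_offdiag // phi0 //; exact: sl_unit0.
Qed.

(** [small_codimension_subalgebra] speaks of annihilators among all matrices, the functionals only
    of traceless ones. The traceless part [tl] mediates: scalar matrices are central and are
    orthogonal to the traceless [trace_dual (phi j)]. *)
Lemma subalgebra_by_functionals (phi : 'I_n -> 'M[R]_n.+1 -> R) : (2 <= n)%N ->
  (forall j, linear_on_sl (phi j)) ->
  (forall A B, sl R n A -> sl R n B -> (forall j, phi j A = 0) -> (forall j, phi j B = 0) ->
    forall j, phi j (A *m B - B *m A) = 0) ->
  (exists j A, sl R n A /\ phi j A <> 0) ->
  (forall s : 'I_n -> R, (forall A, sl R n A -> \sum_j s j * phi j A = 0) -> forall j, s j = 0) /\
  ((exists (u : 'cV[R]_n.+1) (psi : 'I_n -> 'rV[R]_n.+1),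
      forall j, trace_dual (phi j) = u *m psi j) \/
   (exists (u : 'I_n -> 'cV[R]_n.+1) (psi : 'rV[R]_n.+1),
      forall j, trace_dual (phi j) = u j *m psi)).
Proof.
move=> hn lphi clos [j0 [A0 [slA0 phiA0]]].
pose tl A := A - (\tr A / n.+1%:R)%:M.
have sltl A : sl R n (tl A).
  by rewrite /sl /= raddfB /= mxtrace_scalar -[X in _ - X]mulr_natr divfK ?subrr // pnatr_eq0.
have phitl A j : phi j (tl A) = \tr (A *m trace_dual (phi j)).
  rewrite (trace_dualE (lphi j) (sltl A)) mulmxBl raddfB /= mul_scalar_mx mxtraceZ.
  by rewrite trace_dual_traceless // mulr0 subr0.
have [//|j|A B LA LB j||indep types] :=
  @small_codimension_subalgebra R n (fun j => trace_dual (phi j)).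
- exact: trace_dual_traceless.
- rewrite -phitl.
  have -> : tl (A *m B - B *m A) = tl A *m tl B - tl B *m tl A.
    rewrite {1}/tl (sl_bracket A B) mul0r raddf0 subr0 /tl !mulmxBl !mulmxBr.
    by rewrite !mul_scalar_mx !mul_mx_scalar !scale_scalar_mx mulrC !opprB;
      apply/matrixP => ? ?; rewrite !mxE; ring.
  by apply: clos => // k; rewrite phitl; [exact: LA | exact: LB].
- exists j0; apply/eqP => M0; apply: phiA0.
  by rewrite (trace_dualE (lphi j0)) // M0 mulmx0 mxtrace0.
split=> // s sphi; apply: indep.
apply/matrixP => b a; rewrite summxE [RHS]mxE -[RHS](sphi (unit0 a b) (sl_unit0 a b)).
by apply: eq_bigr => j _; rewrite !mxE.
Qed.

End SpecialLinearAlgebra.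


Section Realization.
Context {R : realType} {n : nat}.
Variables (U : set 'rV[R]_n) (rho : 'M[R]_n.+1 -> 'rV[R]_n -> 'rV[R]_n).
Hypotheses (hn : (2 <= n)%N) (oU : open U) (HR : realization U rho).
Implicit Types (A B : 'M[R]_n.+1) (x v p : 'rV[R]_n).

Local Notation e_ i := (delta_mx 0 i : 'rV[R]_n).

Lemma rho_smooth A : sl R n A -> smooth_on U (rho A).
Proof. by case: HR => h _ _; exact: h. Qed.

Lemma rho_linear x j : U x -> linear_on_sl (fun A => rho A x 0 j).
Proof. by case: HR => _ h _ Ux s A B A0 B0; rewrite h // !mxE. Qed.

Lemma rho_is_derive A x v : sl R n A -> U x -> is_derive x v (rho A) (v *m jac (rho A) x).
Proof. by move=> A0 Ux; exact: jac_derive oU (rho_smooth A0) _ _ Ux. Qed.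

Lemma rho_derive A x v : sl R n A -> U x -> 'D_v (rho A) x = v *m jac (rho A) x.
Proof. by move=> A0 Ux; have [_ ->] := rho_is_derive v A0 Ux. Qed.

Lemma rho_bracket A B x : sl R n A -> sl R n B -> U x ->
  rho (A *m B - B *m A) x = rho A x *m jac (rho B) x - rho B x *m jac (rho A) x.
Proof.
by move=> A0 B0 Ux; case: HR => _ _ ->//; rewrite /lie_bracket !rho_derive.
Qed.

Lemma jac_linear x v j : U x -> linear_on_sl (fun A => (v *m jac (rho A) x) 0 j).
Proof.
move=> Ux s A B A0 B0; case: HR => _ rholin _.
have d : is_derive x v (rho (s *: A + B)) (s *: (v *m jac (rho A) x) + v *m jac (rho B) x).
  apply: (@near_eq_is_derive _ _ _ (s \*: rho A + rho B)).
    by apply: filterS (open_nbhs_nbhs (conj oU Ux)) => y Uy; rewrite rholin.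
  exact: is_deriveD (is_deriveZ s (rho_is_derive v A0 Ux)) (rho_is_derive v B0 Ux).
by rewrite -rho_derive //; [have [_ ->] := d; rewrite !mxE | exact: slD].
Qed.

(** Differentiating [rho_bracket] at [p], each second derivative carries a factor [rho C p = 0]; so
    the linear parts at a fixed point form a representation. *)
Lemma jac_bracket_fixed p A B : U p -> (forall C, sl R n C -> rho C p = 0) ->
  sl R n A -> sl R n B ->
  jac (rho (A *m B - B *m A)) p = jac (rho A) p *m jac (rho B) p - jac (rho B) p *m jac (rho A) p.
Proof.
move=> Up fixp A0 B0; apply/matrixP => k j; rewrite [LHS]mxE.
have half C D : sl R n C -> sl R n D ->
    is_derive p (e_ k) (fun x => \sum_i rho C x 0 i * jac (rho D) x i j)
      ((jac (rho C) p *m jac (rho D) p) k j).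
  move=> C0 D0; rewrite [X in is_derive _ _ _ X]mxE; apply: is_derive_sum_pointwise => i.
  have dC : is_derive p (e_ k) (fun x => rho C x 0 i) (jac (rho C) p k i).
    rewrite mxE; apply: DeriveDef => //.
    exact: Ck_derivable (smooth_coord oU (rho_smooth C0) 1 i) Up.
  have dD : is_derive p (e_ k) (fun x => jac (rho D) x i j)
      ('D_(e_ k) (fun x => jac (rho D) x i j) p).
    apply: DeriveDef => //.
    exact: Ck_derivable (Ck_jac oU (rho_smooth D0) 1 i j) Up.
  have z : rho C p 0 i = 0 by rewrite fixp // mxE.
  have -> : jac (rho C) p k i * jac (rho D) p i j =
    rho C p 0 i *: 'D_(e_ k) (fun x => jac (rho D) x i j) p +
    jac (rho D) p i j *: jac (rho C) p k i.
    by rewrite z scale0r add0r /GRing.scale /= mulrC.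
  exact: is_deriveM dC dD.
have d : is_derive p (e_ k) (fun x => rho (A *m B - B *m A) x 0 j)
    ((jac (rho A) p *m jac (rho B) p) k j - (jac (rho B) p *m jac (rho A) p) k j).
  apply: near_eq_is_derive (is_deriveB (half A B A0 B0) (half B A B0 A0)).
  by apply: filterS (open_nbhs_nbhs (conj oU Up)) => y Uy; rewrite rho_bracket // !mxE.
by have [_ ->] := d; rewrite !mxE.
Qed.

(* The stabilizer of the line through [w] under the isotropy representation is a subalgebra
   of codimension less than [n], hence everything; so [sl] acts by commuting
   homotheties. *)
Lemma jac_fixed_trivial p : U p -> (forall C, sl R n C -> rho C p = 0) ->
  forall A, sl R n A -> jac (rho A) p = 0.
Proof.
move=> Up fixp; have eigen (w : 'rV[R]_n) A : sl R n A -> exists c, w *m jac (rho A) p = c *: w.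
  move=> A0; case: (eqVneq w 0) => [->|w0]; first by exists 0; rewrite mul0mx scaler0.
  pose G := cokermx w.
  have inw (v : 'rV[R]_n) : v *m G = 0 -> exists c, v = c *: w.
    move/eqP; rewrite -submxE => /sub_rVP; exact.
  have wG : w *m G = 0 by exact: mulmx_coker.
  pose phi j B := (w *m jac (rho B) p *m G) 0 j.
  have lphi j : linear_on_sl (phi j).
    move=> s B C B0 C0; rewrite /phi.
    have -> : w *m jac (rho (s *: B + C)) p = s *: (w *m jac (rho B) p) + w *m jac (rho C) p.
      by apply/rowP => i; rewrite (jac_linear w i Up) // !mxE.
    by rewrite mulmxDl -scalemxAl !mxE.
  have phi0 B : (forall j, phi j B = 0) -> exists c, w *m jac (rho B) p = c *: w.
    by move=> h; apply: inw; apply/rowP => j; rewrite [LHS]h mxE.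
  apply: (phi0) => j; apply: contrapT => phijA.
  have [||indep _] := subalgebra_by_functionals hn lphi.
  - move=> B C B0 C0 /phi0[b wb] /phi0[c wc] k.
    rewrite /phi jac_bracket_fixed // mulmxBr !mulmxA wb wc -!scalemxAl wb wc !scalerA.
    by rewrite mulrC subrr !mul0mx mxE.
  - by exists j, A; split.
  (* [G] kills the nonzero row [w], so it is singular; a nontrivial relation [s] among its columns
     is a relation among the [phi j], against [indep]. *)
  have nG : kermx G^T != 0.
    rewrite kermx_eq0 row_free_unit unitmx_tr; apply: contraNN w0 => Gunit.
    by rewrite -(mulmxK Gunit w) wG mul0mx.
  have /rowV0Pn[s sG s0] := nG; case/eqP: s0; apply/rowP => i; rewrite mxE.
  have /sub_kermxP/(congr1 trmx) := sG; rewrite trmx_mul trmxK trmx0 => Gs.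
  apply: (indep (fun i => s 0 i)) => B B0.
  have h : (w *m jac (rho B) p *m G *m s^T) 0 0 = 0 by rewrite -(mulmxA _ G) Gs mulmx0 mxE.
  rewrite -[RHS]h [RHS]mxE; apply: eq_bigr => k _. by rewrite [s^T _ _]mxE mulrC.
have comm A B : sl R n A -> sl R n B -> jac (rho (A *m B - B *m A)) p = 0.
  move=> A0 B0; rewrite jac_bracket_fixed //; apply/row_matrixP => i.
  rewrite row0 rowE mulmxBr !mulmxA.
  have [c cE] := eigen (e_ i) A A0; have [c' c'E] := eigen (e_ i) B B0.
  by rewrite cE c'E -!scalemxAl cE c'E !scalerA mulrC subrr.
move=> A A0; apply/matrixP => k j; rewrite [RHS]mxE.
have := perfect_sl (jac_linear (e_ k) j Up) _ A0; rewrite -rowE mxE; apply=> B C B0 C0.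
by rewrite comm // mulmx0 mxE.
Qed.

(** Each [unit0 a b] is a combination of brackets of such matrices with total weight at most one,
    and [rho_bracket] bounds a bracket by two products of a value with a small Jacobian. *)
Lemma rho_mx_unit0_le (e d : R) p : 0 < e ->
  (forall x v a b, `|x - p| < d -> `|v *m jac (rho (unit0 a b)) x| <= e * `|v|) ->
  forall x, U x -> `|x - p| < d -> forall a b,
    `|rho (unit0 a b) x| <= e * 2 * \sum_c \sum_c' `|rho (unit0 c c') x|.
Proof.
move=> e0 small x Ux xp; set mu := \sum_c _.
have le_mu a b : `|rho (unit0 a b) x| <= mu.
  rewrite /mu (bigD1 a) //= (bigD1 b) //= -addrA lerDl addr_ge0 //; first exact: sumr_ge0.
  by apply: sumr_ge0 => ? _; exact: sumr_ge0.
have mu0 : 0 <= mu by apply: le_trans (le_mu ord0 ord0).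
have br a b c c' : `|rho (unit0 a b *m unit0 c c' - unit0 c c' *m unit0 a b) x| <= e * 2 * mu.
  rewrite rho_bracket //; try exact: sl_unit0.
  apply: le_trans (ler_normB _ _) _; rewrite -mulrA mulrDl mul1r mulrDr lerD //;
  by apply: le_trans (small _ _ _ _ xp) _; rewrite ler_pM2l.
move=> a b; case: (eqVneq a b) => [<-|ab]; last by rewrite unit0_offdiag.
have -> : rho (unit0 a a) x = \sum_(b | b != a)
    n.+1%:R^-1 *: rho (unit0 a b *m unit0 b a - unit0 b a *m unit0 a b) x.
  apply/rowP => j; rewrite {1}unit0_diag (linear_on_sl_sum _ _ _ (rho_linear j Ux)).
    by rewrite summxE; apply: eq_bigr => c _; rewrite mxE.
  by move=> c; exact: sl_bracket.
apply: le_trans (ler_norm_sum _ _ _) _.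
apply: (@le_trans _ _ (\sum_(b : 'I_n.+1) n.+1%:R^-1 * (e * 2 * mu))).
  rewrite [leRHS](bigD1 a) //= ler_wpDl //; first by rewrite !mulr_ge0 // ?ltW // invr_ge0.
  by apply: ler_sum => c _; rewrite normrZ ger0_norm ?invr_ge0 // ler_wpM2l ?invr_ge0.
by rewrite sumr_const card_ord -[leLHS]mulr_natl mulrA divff ?mul1r // pnatr_eq0.
Qed.

Lemma fixed_points_open p : U p -> (forall C, sl R n C -> rho C p = 0) ->
  exists2 d : R, 0 < d &
    forall x, `|x - p| < d -> U x /\ forall C, sl R n C -> rho C x = 0.
Proof.
move=> Up fixp.
(* The constant [e] is [1 / (4 N^3)]: one factor [N] passes from entries of the Jacobian to its
   action on vectors, two come from summing over all [unit0 c c'], and with the factor 2 of the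
   preceding lemma the sum [mu] satisfies [mu <= mu / 2]. *)
have [d1 d10 d1U] := (open_radiusP U).1 oU p Up.
pose N : R := n.+1%:R; have N0 : 0 < N by rewrite ltr0n.
pose e : R := (N * (N * (N * 4)))^-1.
have e0 : 0 < e by rewrite invr_gt0 !mulr_gt0.
have /choice[d dP] (t : ('I_n.+1 * 'I_n.+1) * ('I_n * 'I_n)) : exists d : R, 0 < d /\
    forall x, `|x - p| < d -> `|jac (rho (unit0 t.1.1 t.1.2)) x t.2.1 t.2.2| < e.
  case: t => [[a b] [i j]] /=.
  have sab : sl R n (unit0 a b) := sl_unit0 a b.
  have /continuous_epsP/(_ _ e0)[d d0 dP] :=
    Ck_continuous (Ck_jac oU (rho_smooth sab) 0 i j) Up.
  exists d; split=> // x /dP; by rewrite (_ : jac _ p i j = 0) ?subr0 // jac_fixed_trivial // mxE.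
pose d0 := \big[Num.min/d1]_t d t.
have d00 : 0 < d0 by apply/bigmin_gtP; split=> // t _; case: (dP t).
exists d0 => // x xp; have Ux : U x by apply: d1U; apply: lt_le_trans xp _; exact: bigmin_le_id.
split=> //.
have small y v a b : `|y - p| < d0 -> `|v *m jac (rho (unit0 a b)) y| <= (N * e) * `|v|.
  move=> yp; apply: row_norm_le => [|j]; first by rewrite !mulr_ge0 // ltW.
  rewrite mxE; apply: le_trans (ler_norm_sum _ _ _) _.
  apply: (@le_trans _ _ (\sum_(i < n) e * `|v|)).
    apply: ler_sum => i _; rewrite normrM mulrC ler_pM ?coord_le_norm //.
    have [_ /(_ y)] := dP ((a, b), (i, j)); move=> /(_ _)/ltW; apply.
    by apply: lt_le_trans yp _; exact: bigmin_le_cond.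
  rewrite sumr_const card_ord -[leLHS]mulr_natl -mulrA ler_wpM2r ?mulr_ge0 ?(ltW e0) //.
  by rewrite ler_nat.
have bound := rho_mx_unit0_le (mulr_gt0 N0 e0) small Ux xp.
set mu := \sum_c _ in bound.
have mu0 : mu <= 0.
  have : mu <= \sum_(c : 'I_n.+1) \sum_(c' : 'I_n.+1) N * e * 2 * mu.
    by apply: ler_sum => c _; apply: ler_sum => c' _; exact: bound.
  rewrite !sumr_const !card_ord -!mulrnA -[leRHS]mulr_natl natrM -/N.
  have eE : N * (N * (N * 4)) * e = 1 by rewrite divff // gt_eqF // !mulr_gt0.
  rewrite (_ : N * N * (N * e * 2 * mu) = N * (N * (N * 4)) * e * (mu / 2)); last by field.
  by rewrite eE mul1r; lra.
have unit0x a b : rho (unit0 a b) x = 0.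
  apply/eqP; rewrite -normr_le0; apply: le_trans (bound a b) _.
  by rewrite mulr_ge0_le0 // !mulr_ge0 // ltW.
move=> C C0; apply/rowP => j; rewrite (trace_dualE (rho_linear j Ux) C0) mxE.
rewrite [trace_dual _](_ : _ = 0) ?mulmx0 ?mxtrace0 //.
by apply/matrixP => b a; rewrite !mxE unit0x mxE.
Qed.

Lemma no_fixed_point p : connected U -> nontrivial U rho -> U p ->
  exists C, sl R n C /\ rho C p <> 0.
Proof.
move=> cU [C0 [x0 [slC0 Ux0 Cx0]]] Up; apply: contrapT => nofix.
pose Z := [set x | U x /\ forall C, sl R n C -> rho C x = 0].
have ZU : Z = U.
  apply: cU.
  - exists p; split=> // C slC; apply: contrapT => Cp; apply: nofix; by exists C.
  - exists Z; last by apply/seteqP; split=> x; [move=> [Ux zx]; split|case].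
    apply/open_radiusP => x [Ux zx]; have [d d0 dP] := fixed_points_open Ux zx.
    by exists d.
  - exists (~` [set x | U x /\ exists C, sl R n C /\ rho C x <> 0]); last first.
      apply/seteqP; split=> x [Ux zx]; split=> //.
        by case=> _ [C [slC]]; apply; exact: zx.
      by move=> C slC; apply: contrapT => Cx; apply: zx; split=> //; exists C.
    rewrite closedC; apply/open_radiusP => x [Ux [C [slC Cx]]].
    have Cx0' : 0 < `|rho C x| by rewrite normr_gt0; apply/eqP.
    have [dc _] := rho_smooth slC 0; have /continuous_epsP/(_ _ Cx0')[d d0 dP] := dc x Ux.
    have [d1 d10 d1U] := (open_radiusP U).1 oU x Ux.
    exists (Num.min d d1); first by rewrite lt_min d0.
    move=> y; rewrite lt_min => /andP[yd yd1]; split; first exact: d1U.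
    exists C; split=> // Cy; have := dP y yd; rewrite Cy sub0r normrN ltxx.
    by [].
have [_ /(_ C0 slC0)/eqP] : Z x0 by rewrite ZU.
by rewrite (negPf Cx0).
Qed.

End Realization.


(** * The equivariant chart *)

Section LineChart.
Context {R : realType} {n : nat}.
Variables (U : set 'rV[R]_n) (rho : 'M[R]_n.+1 -> 'rV[R]_n -> 'rV[R]_n).
Hypotheses (hn : (2 <= n)%N) (oU : open U) (HR : realization U rho).
Hypothesis nofix : forall x, U x -> exists C, sl R n C /\ rho C x <> 0.
Implicit Types (A B : 'M[R]_n.+1) (x v p : 'rV[R]_n) (i j : 'I_n) (a b c k : 'I_n.+1).

Local Notation e_ i := (delta_mx 0 i : 'rV[R]_n).

(** The moment map of the action at the covector [dx_j] over [x], with [sl] identified with its dual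
    by the trace form. *)
Definition moment j x : 'M[R]_n.+1 := trace_dual (fun A => rho A x 0 j).

Lemma momentE A x j : sl R n A -> U x -> rho A x 0 j = \tr (A *m moment j x).
Proof. by move=> A0 Ux; exact: (trace_dualE (rho_linear HR j Ux) A0). Qed.

Lemma moment_traceless x j : U x -> \tr (moment j x) = 0.
Proof. by move=> Ux; exact: trace_dual_traceless (rho_linear HR j Ux). Qed.

Lemma Ck_moment m j b a : Ck m U (fun x => moment j x b a).
Proof.
have s0 : sl R n (unit0 a b) := sl_unit0 a b.
apply: Ck_eq (smooth_coord oU (rho_smooth HR s0) m j) => // x _.
by rewrite mxE.
Qed.

(** Two fields vanishing at [x] have a bracket vanishing at [x], so the isotropy is a subalgebra.
    The first conclusion is transitivity: no nonzero covector kills all values of the fields at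
    [x]. *)
Lemma moment_types x : U x ->
  (forall s : 'I_n -> R, (forall A, sl R n A -> \sum_j s j * rho A x 0 j = 0) ->
    forall j, s j = 0) /\
  ((exists (u : 'cV[R]_n.+1) (psi : 'I_n -> 'rV[R]_n.+1), forall j, moment j x = u *m psi j) \/
   (exists (u : 'I_n -> 'cV[R]_n.+1) (psi : 'rV[R]_n.+1), forall j, moment j x = u j *m psi)).
Proof.
move=> Ux; apply: (@subalgebra_by_functionals R n (fun j A => rho A x 0 j)) => //.
- by move=> j; exact: (rho_linear HR j Ux).
- move=> A B A0 B0 fA fB j; rewrite (rho_bracket oU HR) //.
  have -> : rho A x = 0 by apply/rowP => i; rewrite fA mxE.
  have -> : rho B x = 0 by apply/rowP => i; rewrite fB mxE.
  by rewrite !mul0mx subrr mxE.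
- have [C [C0 Cx]] := nofix Ux; apply: contrapT => none; apply: Cx.
  apply/rowP => j; rewrite mxE; apply: contrapT => Cj; apply: none.
  by exists j, C.
Qed.

(** A continuous function separates the types. If all moments share a row up to scale, then the rows
    [c] of two moments are parallel and every [minor] vanishes; at [p] some [minor] is nonzero
    because two moments with common column are independent. *)
Lemma line_type_open p (u : 'cV[R]_n.+1) (psi : 'I_n -> 'rV[R]_n.+1) : U p ->
  (forall j, moment j p = u *m psi j) ->
  exists2 d : R, 0 < d & forall x, `|x - p| < d -> U x /\
    exists (u : 'cV[R]_n.+1) (psi : 'I_n -> 'rV[R]_n.+1), forall j, moment j x = u *m psi j.
Proof.
move=> Up Mp; have [indep _] := moment_types Up.
have j0n : (0 < n)%N by lia.
pose j0 := Ordinal j0n; pose j1 := Ordinal (hn : (1 < n)%N).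
have j01 : (j0 == j1) = false by [].
have j10 : (j1 == j0) = false by [].
pose minor c a b x :=
  moment j0 x c a * moment j1 x c b - moment j0 x c b * moment j1 x c a.
have [c [a [b minorp]]] : exists c a b, minor c a b p != 0.
  apply: contrapT => none.
  have minor0 c a b : minor c a b p = 0.
    by apply: contrapT => /eqP mp; apply: none; exists c, a, b.
  have dep (s0 s1 : R) :
      (forall a b, s0 * moment j0 p a b + s1 * moment j1 p a b = 0) -> s0 = 0 /\ s1 = 0.
    move=> dep; pose s j := (j == j0)%:R * s0 + (j == j1)%:R * s1.
    have sums (F : 'I_n -> R) : \sum_j s j * F j = s0 * F j0 + s1 * F j1.
      rewrite (bigD1 j0) //= (bigD1 j1) //=.
      rewrite big1 ?addr0 => [|j /andP[/negPf jj0 /negPf jj1]].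
        by rewrite /s !eqxx ?j01 ?j10 !mul0r !mul1r addr0 add0r.
      by rewrite /s jj0 jj1 !mul0r addr0 mul0r.
    have s00 : forall j, s j = 0.
      apply: indep => A A0; rewrite sums !momentE // -!mxtraceZ -mxtraceD !scalemxAr -mulmxDr.
      rewrite (_ : _ + _ = 0) ?mulmx0 ?mxtrace0 //.
      by apply/matrixP => a b; rewrite [RHS]mxE -(dep a b) !mxE.
    have := s00 j1; have := s00 j0; rewrite /s !eqxx ?j01 ?j10.
    by rewrite !mul0r !mul1r addr0 add0r.
  have [c [a Mca]] : exists c a, moment j0 p c a != 0.
    apply: contrapT => M0; have [|/eqP] := dep 1 0; last by rewrite oner_eq0.
    move=> a b; rewrite mul0r addr0 mul1r; apply: contrapT => /eqP Mab; apply: M0.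
    by exists a, b.
  (* If all minors vanish, row [c] already yields a linear relation between the two moments, since
     every other row is proportional to it through [u]. *)
  have [|_ /eqP] := dep (- moment j1 p c a) (moment j0 p c a); last by rewrite (negPf Mca).
  move=> d b; have := minor0 c a b; rewrite /minor !Mp !mxE !big_ord1 => h.
  have uc : u c 0 != 0 by move: Mca; rewrite Mp mxE big_ord1 mulf_eq0 negb_or => /andP[].
  apply: (mulfI uc); rewrite mulr0; rewrite -[RHS](mulr0 (u d 0)) -h; ring.
have Cm : Ck 0 U (minor c a b).
  by apply: CkB => //; apply: CkM => //; exact: Ck_moment.
have mp0 : 0 < `|minor c a b p| by rewrite normr_gt0.
have /continuous_epsP/(_ _ mp0)[d d0 dP] := Ck_continuous Cm Up.
have [d1 d10 d1U] := (open_radiusP U).1 oU p Up.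
exists (Num.min d d1); first by rewrite lt_min d0.
move=> x; rewrite lt_min => /andP[xd /d1U Ux]; split=> //.
have [_ [//|[u' [psi' Mx]]]] := moment_types Ux.
have := dP x xd; rewrite {1}/minor !Mx !mxE !big_ord1.
rewrite (_ : _ - _ = 0 - minor c a b p); last by ring.
by rewrite sub0r normrN ltxx.
Qed.

(* Differentiating [rho A = 0] along [rho B] shows that the annihilator of the moments is
   moved by [- ad B]. *)
Lemma moment_derive x (u : 'cV[R]_n.+1) (psi : 'I_n -> 'rV[R]_n.+1) B j : U x ->
  (forall j, moment j x = u *m psi j) -> sl R n B ->
  exists chi : 'rV[R]_n.+1, forall k a,
    is_derive x (rho B x) (fun y => moment j y k a)
      (u k 0 * chi 0 a - (B *m u) k 0 * psi j 0 a).
Proof.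
move=> Ux Mx B0; set X := rho B x.
have lC := jac_linear oU HR X j Ux.
pose C := trace_dual (fun A => (X *m jac (rho A) x) 0 j).
(* [C] is the derivative of the moment along [rho B], and [Q] its deviation from the infinitesimal
   conjugation by [B]. It pairs to zero with the isotropy, so it lies in the span of the moments. *)
pose Q := C - (moment j x *m B - B *m moment j x).
have trB (M N : 'M[R]_n.+1) : \tr (M - N) = \tr M - \tr N by exact: raddfB.
have Q0 : \tr Q = 0.
  by rewrite /Q !trB (trace_dual_traceless lC) (mxtrace_mulC B) subrr subr0.
have [A LA|s QE] := @span_of_annihilated R n (fun i => moment i x) Q.
  have [A' [tA' A'0]] : exists A', (forall M : 'M[R]_n.+1, \tr M = 0 ->
      \tr (A' *m M) = \tr (A *m M)) /\ sl R n A'.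
    exists (A - (\tr A / n.+1%:R)%:M); split=> [M M0|].
      by rewrite mulmxBl trB mul_scalar_mx mxtraceZ M0 mulr0 subr0.
    by rewrite /sl /= trB mxtrace_scalar -[X in _ - X]mulr_natr divfK ?subrr // pnatr_eq0.
  have rA' : rho A' x = 0.
    by apply/rowP => i; rewrite momentE // tA' ?moment_traceless // LA mxE.
  rewrite -tA' // /Q mulmxBr trB -(trace_dualE lC A'0).
  have := rho_bracket oU HR B0 A'0 Ux; rewrite rA' mul0mx subr0 => <-.
  rewrite momentE //; last exact: sl_bracket.
  rewrite mulmxBl mulmxBr !trB !mulmxA (mxtrace_mulC _ B) !mulmxA.
  by rewrite subrr.
(* Every term with left factor [u] goes into [chi]; only [- B u psi_j] can move the line spanned by
   [u]. *)
exists (\sum_i s i *: psi i + psi j *m B) => k a.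
have s0 : sl R n (unit0 a k) := sl_unit0 a k.
have d : is_derive x X (fun y => moment j y k a) (C k a).
  have /derivable_mxP/(_ 0 j) dk : derivable (rho (unit0 a k)) x X.
    by have [] := rho_is_derive oU HR X s0 Ux.
  have E : (fun y => moment j y k a) = (fun y => rho (unit0 a k) y 0 j).
    by apply/funext => y; rewrite mxE.
  rewrite E; apply: DeriveDef => //.
  by rewrite mxE -(rho_derive oU HR) // derive_mx ?mxE //; have [] := rho_is_derive oU HR X s0 Ux.
rewrite (_ : _ - _ = C k a) //.
have -> : C = Q + (moment j x *m B - B *m moment j x) by rewrite subrK.
rewrite QE; have -> : \sum_i s i *: moment i x = u *m \sum_i s i *: psi i.
  by rewrite mulmx_sumr; apply: eq_bigr => i _; rewrite Mx scalemxAr.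
rewrite Mx -mulmxA addrA -mulmxDr mulmxA.
move: (\sum_i _ + _) => chi; rewrite !mxE !big_ord1.
by congr (_ - _); rewrite ?mxE ?big_ord1.
Qed.

End LineChart.


(** The fields of the positive simple roots are triangular: they are positive multiples of
    [partial i.+1 - partial i], so a covector killing them has all its entries equal to the
    preceding one, starting from zero. *)
Lemma log_field_spanning {R : realType} {n : nat} (y : 'rV[R]_n) (c : 'cV[R]_n) :
  (forall A, sl R n A -> log_field A y *m c = 0) -> c = 0.
Proof.
move=> cA.
suff c0 m : forall i : 'I_n, (i < m)%N -> c i 0 = 0.
  by apply/colP => i; rewrite mxE (c0 n).
elim: m => [//|m IH] i; rewrite ltnS => im.
have [[A [slA _ _] AE] _] := log_field_given_by (R := R) i.
have := cA A slA; rewrite AE /X1_pos -scalemxAl => /eqP.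
rewrite scaler_eq0 gt_eqF ?expR_gt0 //= mulmxBl subr_eq0 => /eqP/matrixP/(_ 0 0).
rewrite !mxE (bigD1 i) //= mxE eqxx mul1r big1 ?addr0 => [->|j ji]; last first.
  by rewrite mxE eqSS [_ == _](negPf ji) mul0r.
rewrite big1 // => j _; rewrite mxE; case: eqP => [ji|_]; last by rewrite mul0r.
by rewrite mul1r IH //; lia.
Qed.

Section LineChart.
Context {R : realType} {n : nat}.
Variables (U : set 'rV[R]_n) (rho : 'M[R]_n.+1 -> 'rV[R]_n -> 'rV[R]_n).
Hypotheses (hn : (2 <= n)%N) (oU : open U) (HR : realization U rho).
Hypothesis nofix : forall x, U x -> exists C, sl R n C /\ rho C x <> 0.
Implicit Types (A B : 'M[R]_n.+1) (x v p : 'rV[R]_n) (i j : 'I_n) (a b c k : 'I_n.+1).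

(* The column [a] of [moment j x = u(x) psi_j(x)] spans the line fixed by the isotropy
   subalgebra at [x]; its logarithmic coordinates give the chart. *)
Lemma line_chart p (psi : 'I_n -> 'rV[R]_n.+1) : U p ->
  (forall j, moment rho j p = (const_mx 1 : 'cV[R]_n.+1) *m psi j) ->
  exists (W V : set 'rV[R]_n) (f g : 'rV[R]_n -> 'rV[R]_n),
    [/\ W p, W `<=` U, local_diffeo_with_inverse W V f g &
        forall A, sl R n A -> pushes_to W f (rho A) (log_field A)].
Proof.
move=> Up Mp.
have Mpk j k a : moment rho j p k a = psi j 0 a by rewrite Mp !mxE big_ord1 mxE mul1r.
have [j [a ja]] : exists j a, psi j 0 a != 0.
  apply: contrapT => none; have [C [C0 Cp]] := nofix Up; apply: Cp.
  apply/rowP => j; rewrite (momentE HR) // [RHS]mxE Mp (_ : psi j = 0) ?mulmx0 ?mxtrace0 //.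
  apply/rowP => a; rewrite mxE; apply: contrapT => /eqP ja; apply: none.
  by exists j, a.
(* Division by the entry at [p] makes every [v k p] equal to 1, so all [v k] are positive near [p]
   and their logarithms are defined there. *)
pose t := psi j 0 a; pose v k x := moment rho j x k a / t.
have vp k : v k p = 1 by rewrite /v Mpk divff.
have Cv m k : Ck m U (v k).
  by apply: CkM => //; [exact: Ck_moment | exact: Ck_cst].
have [d0 d00 d0P] := line_type_open hn oU HR nofix Up Mp.
have /choice[d dP] k : exists d : R, 0 < d /\ forall x, `|x - p| < d -> 0 < v k x.
  have /continuous_epsP/(_ 1 ltr01)[d d1 dP] := Ck_continuous (Cv 0%N k) Up.
  by exists d; split=> // x /dP; rewrite vp ltr_norml; lra.
pose r := \big[Num.min/d0]_k d k.
have r0 : 0 < r by apply/bigmin_gtP; split=> // k _; case: (dP k).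
pose W0 := [set x : 'rV[R]_n | `|x - p| < r].
have oW0 : open W0.
  apply/open_radiusP => x; rewrite /W0 /= => xr.
  exists (r - `|x - p|); first by rewrite subr_gt0.
  by move=> y yx; have := ler_normD (y - x) (x - p); rewrite addrA subrK; lra.
have W0p : W0 p by rewrite /W0 /= subrr normr0.
have W0d x : W0 x -> `|x - p| < d0.
  by move=> xr; apply: lt_le_trans xr _; exact: bigmin_le_id.
have W0U x : W0 x -> U x by move=> /W0d/d0P[].
have v0 k x : W0 x -> 0 < v k x.
  move=> xr; have [_] := dP k; apply; apply: lt_le_trans xr _; exact: bigmin_le_cond.
pose L k x := ln (v k x).
have CL m k : Ck m W0 (L k).
  by apply: Ck_ln => // [x|]; [exact: v0 | exact: Ck_sub W0U (Cv m k)].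
pose f x : 'rV[R]_n := \row_i (L (lift ord0 i) x - L (widen_ord (leqnSn n) i) x).
have fsmooth : smooth_on W0 f.
  move=> m; apply/class_CP => // i.
  apply: (Ck_eq (g := fun x => L (lift ord0 i) x - L (widen_ord (leqnSn n) i) x)) => //.
    by move=> x _; rewrite mxE.
  exact: CkB.
(* The shift [s] is the same for all [k]: it comes from the multiple of [u] that [moment_derive]
   leaves undetermined, and it cancels in the differences that make up [f]. *)
have Lderive x B : W0 x -> sl R n B -> exists s : R, forall k,
    is_derive x (rho B x) (L k) (s + log_component B k (f x)).
  move=> Wx B0; have Ux := W0U x Wx.
  have [_ [u [psi' Mx]]] := d0P x (W0d x Wx).
  have [chi Md] := moment_derive oU HR j Ux Mx B0.
  have vk k : v k x = u k 0 * psi' j 0 a / t by rewrite /v Mx mxE big_ord1.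
  have psi0 : psi' j 0 a != 0.
    by have := v0 ord0 x Wx; rewrite vk; apply: contraTneq => ->; rewrite mulr0 mul0r ltxx.
  exists (chi 0 a / psi' j 0 a) => k.
  have vd : is_derive x (rho B x) (v k)
      (t^-1 * (u k 0 * chi 0 a - (B *m u) k 0 * psi' j 0 a)).
    have -> : v k = t^-1 \*: (fun y => moment rho j y k a).
      by apply/funext => y; rewrite /v mulrC.
    exact: is_deriveZ.
  have vkn0 b : v b x != 0 by rewrite gt_eqF // v0.
  have uk b : u b 0 = v b x * t / psi' j 0 a.
    by rewrite vk divfK // mulfK.
  have -> : chi 0 a / psi' j 0 a + log_component B k (f x) =
      (v k x)^-1 * (t^-1 * (u k 0 * chi 0 a - (B *m u) k 0 * psi' j 0 a)).
    rewrite mxE !mulrBr; congr (_ + _).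
      by rewrite uk; field; rewrite psi0 ja vkn0.
    rewrite /log_component; congr (- _); rewrite mulr_suml !mulr_sumr.
    apply: eq_bigr => b _.
    rewrite !(log_sum_telescope (fun k => L k x)).
    rewrite (_ : _ - _ - _ = L b x - L k x); last by ring.
    rewrite expRB !lnK ?posrE ?v0 // uk; field.
    by rewrite psi0 ja vkn0.
  by apply: is_derive_comp1 vd; exact: is_derive1_ln (v0 k x Wx).
have fpush A x : sl R n A -> W0 x -> is_derive x (rho A x) f (log_field A (f x)).
  move=> A0 Wx; have [s Ld] := Lderive x A Wx A0.
  have d' i : is_derive x (rho A x) (fun y => f y 0 i) (log_field A (f x) 0 i).
    have -> : (fun y => f y 0 i) = L (lift ord0 i) - L (widen_ord (leqnSn n) i).
      by apply/funext => y; rewrite mxE.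
    rewrite mxE; apply: is_derive_eq (is_deriveB (Ld _) (Ld _)) _; ring.
  have fd : derivable f x (rho A x).
    by apply/derivable_mxP => ? i; rewrite ord1; case: (d' i).
  apply: DeriveDef => //; rewrite derive_mx //; apply/rowP => i; rewrite mxE.
  by have [_ ->] := d' i.
(* The Jacobian sends [rho A p] to [log_field A (f p)], and these images span the whole space. *)
have junit : jac f p \in unitmx.
  rewrite -unitmx_tr -row_free_unit; apply/inj_row_free => c /(congr1 trmx).
  rewrite trmx_mul trmxK trmx0 => jc; apply: trmx_inj; rewrite trmx0.
  apply: (@log_field_spanning R n (f p)) => A A0.
  have [_ <-] := fpush A p A0 W0p.
  have [_ ->] := jac_derive oW0 fsmooth (rho A p) W0p.
  by rewrite -mulmxA jc mulmx0.
have [W [V [g [Wp WW0 loc]]]] := inverse_function oW0 W0p fsmooth junit.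
exists W, V, f, g; split=> //; first by move=> x /WW0/W0U.
by move=> A A0 x /WW0 Wx; have [_ ->] := fpush A x A0 Wx.
Qed.

End LineChart.


(** * Automorphisms of the special linear algebra and charts for both isotropy types *)

Section Automorphisms.
Context {R : realType} {n : nat}.
Variables (U : set 'rV[R]_n) (rho : 'M[R]_n.+1 -> 'rV[R]_n -> 'rV[R]_n).
Hypotheses (hn : (2 <= n)%N) (oU : open U).
Implicit Types (A B : 'M[R]_n.+1) (x p : 'rV[R]_n).

Lemma realization_precomp (tau : 'M[R]_n.+1 -> 'M[R]_n.+1) :
  (forall A, sl R n A -> sl R n (tau A)) ->
  (forall (s : R) A B, tau (s *: A + B) = s *: tau A + tau B) ->
  (forall A B, tau (A *m B - B *m A) = tau A *m tau B - tau B *m tau A) ->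
  realization U rho -> realization U (rho \o tau).
Proof.
move=> tsl tlin tbr [rs rlin rbr]; split=> [A A0|s A B x A0 B0 Ux|A B x A0 B0 Ux] /=.
- by apply: rs; exact: tsl.
- by rewrite tlin rlin //; exact: tsl.
- by rewrite tbr rbr //; exact: tsl.
Qed.

Lemma trace_dual_unique (phi : 'M[R]_n.+1 -> R) (Q : 'M[R]_n.+1) :
  (forall A, sl R n A -> phi A = \tr (A *m Q)) -> \tr Q = 0 -> trace_dual phi = Q.
Proof.
move=> phiQ Q0; apply/matrixP => b a; rewrite mxE phiQ; last exact: sl_unit0.
rewrite /unit0 mulmxBl raddfB /= mul_scalar_mx mxtraceZ Q0 mulr0 subr0.
rewrite /mxtrace (bigD1 a) //= mxE (bigD1 b) //= mxE !eqxx mul1r !big1 ?addr0 // => i /negPf ia.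
  by rewrite mxE big1 // => k _; rewrite mxE ia mul0r.
by rewrite mxE ia andbF mul0r.
Qed.

(** [tau] absorbs the conjugation and the map [A |-> - A^T] used on the way; being onto [sl], it
    leaves the algebra of fields unchanged as a set. *)
Definition pushes_to_log_field W f (sigma : 'M[R]_n.+1 -> 'rV[R]_n -> 'rV[R]_n) :=
  exists tau : 'M[R]_n.+1 -> 'M[R]_n.+1,
    [/\ forall A, sl R n A -> sl R n (tau A),
        forall A, sl R n A -> exists2 B, sl R n B & tau B = A &
        forall A, sl R n A -> pushes_to W f (sigma (tau A)) (log_field A)].

(** Conjugation by a [g] with [g u] the all-ones column replaces each moment [M] by [g M g^-1],
    which puts [p] in the position that [line_chart] expects. *)
Lemma chart_of_line_type p (u : 'cV[R]_n.+1) (psi : 'I_n -> 'rV[R]_n.+1) : realization U rho ->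
  (forall x, U x -> exists C, sl R n C /\ rho C x <> 0) -> U p ->
  (forall j, moment rho j p = u *m psi j) ->
  exists (W V : set 'rV[R]_n) (f g : 'rV[R]_n -> 'rV[R]_n),
    [/\ W p, W `<=` U, local_diffeo_with_inverse W V f g & pushes_to_log_field W f rho].
Proof.
move=> HR nofix Up Mp.
have u0 : u != 0.
  apply/eqP => u0; have [C [C0 Cp]] := nofix p Up; apply: Cp; apply/rowP => j.
  by rewrite (momentE HR) // Mp u0 mul0mx mulmx0 mxtrace0 mxE.
have [g gunit gu] : exists2 g : 'M[R]_n.+1, g \in unitmx & g *m u = const_mx 1.
  have ufree : row_free u^T by rewrite /row_free rank_rV -(inj_eq trmx_inj) trmxK trmx0 u0.
  have /row_freeP[X uX] := ufree.
  have rk : \rank (u^T *m (X *m (const_mx 1 : 'rV[R]_n.+1))) = \rank u^T.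
    rewrite mulmxA uX mul1mx (eqP ufree) rank_rV; case: eqP => // /rowP/(_ ord0).
    by rewrite !mxE => /eqP; rewrite oner_eq0.
  have [g gunit ug] := complete_unitmx rk.
  exists g^T; first by rewrite unitmx_tr.
  apply: trmx_inj; rewrite trmx_mul trmxK -ug mulmxA uX mul1mx.
  by apply/rowP => i; rewrite !mxE.
pose tau A := invmx g *m A *m g.
have tsl A : sl R n A -> sl R n (tau A).
  by rewrite /sl /= /tau => A0; rewrite mxtrace_mulC mulmxA mulmxV // mul1mx.
have HRt : realization U (rho \o tau).
  apply: realization_precomp => // [s A B|A B].
    by rewrite /tau mulmxDr mulmxDl -scalemxAr -scalemxAl.
  rewrite /tau mulmxBr mulmxBl !mulmxA; congr (_ - _).
    by rewrite -(mulmxA (invmx g *m A) g) mulmxV // mulmx1.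
  by rewrite -(mulmxA (invmx g *m B) g) mulmxV // mulmx1.
have tsurj A : sl R n A -> exists2 B, sl R n B & tau B = A.
  move=> A0; exists (g *m A *m invmx g).
    by rewrite /sl /= mxtrace_mulC mulmxA mulVmx // mul1mx.
  by rewrite /tau !mulmxA mulVmx // mul1mx -mulmxA mulVmx // mulmx1.
have [||W [V [f [h [Wp WU loc push]]]]] :=
    line_chart hn oU HRt (p := p) (psi := fun j => psi j *m invmx g) _ Up.
- move=> x Ux; have [C [C0 Cx]] := nofix x Ux; have [B B0 BC] := tsurj C C0.
  by exists B; rewrite /= BC.
- move=> j; apply: trace_dual_unique => [A A0|].
    rewrite /= (momentE HR) //; last exact: tsl.
    by rewrite Mp -gu /tau -!mulmxA mxtrace_mulC !mulmxA.
  rewrite -gu mxtrace_mulC -!mulmxA (mulmxA (invmx g)) mulVmx // mul1mx mxtrace_mulC -Mp.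
  exact: (moment_traceless HR j Up).
by exists W, V, f, h; split=> //; exists tau.
Qed.

End Automorphisms.

Lemma log_field_chart {R : realType} {n : nat} (U : set 'rV[R]_n)
    (rho : 'M[R]_n.+1 -> 'rV[R]_n -> 'rV[R]_n) p :
  (2 <= n)%N -> open U -> realization U rho ->
  (forall x, U x -> exists C, sl R n C /\ rho C x <> 0) -> U p ->
  exists (W V : set 'rV[R]_n) (f g : 'rV[R]_n -> 'rV[R]_n),
    [/\ W p, W `<=` U, local_diffeo_with_inverse W V f g & pushes_to_log_field W f rho].
Proof.
move=> hn oU HR nofix Up.
have [_ [[u [psi Mp]]|[u [psi Mp]]]] := moment_types hn oU HR nofix Up.
  exact: chart_of_line_type Mp.
pose tau (A : 'M[R]_n.+1) := - A^T.
have tsl A : sl R n A -> sl R n (tau A).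
  by rewrite /sl /= /tau => A0; rewrite raddfN /= mxtrace_tr A0 oppr0.
have tauK A : tau (tau A) = A by rewrite /tau raddfN /= trmxK opprK.
have HRt : realization U (rho \o tau).
  apply: realization_precomp => // [s A B|A B].
    by rewrite /tau linearP /= opprD scalerN.
  rewrite /tau raddfB /= !trmx_mul !mulNmx !mulmxN !opprK opprB.
  by [].
(* The moments of [rho \o tau] are the negated transposes of those of [rho], so the common row [psi]
   becomes a common column. *)
have [||W [V [f [g [Wp WU loc [sigma [ssl ssurj push]]]]]]] :=
    chart_of_line_type hn oU (p := p) (u := psi^T) (psi := fun j => - (u j)^T) HRt _ Up.
- move=> x Ux; have [C [C0 Cx]] := nofix x Ux.
  by exists (tau C); split; [exact: tsl | rewrite /= tauK].
- move=> j; apply: trace_dual_unique => [A A0|].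
    rewrite /= (momentE HR) //; last exact: tsl.
    rewrite Mp /tau mulNmx !mulmxN raddfN [RHS]raddfN /= -trmx_mul; congr (- _).
    by rewrite -mxtrace_tr [in LHS]trmx_mul trmxK mxtrace_mulC.
  rewrite mulmxN raddfN /= -trmx_mul mxtrace_tr -Mp (moment_traceless HR j Up) oppr0.
  by [].
exists W, V, f, g; split=> //; exists (tau \o sigma); split=> [A A0|A A0|A A0] /=.
- by apply: tsl; exact: ssl.
- have [B B0 BA] := ssurj (tau A) (tsl A A0); exists B => //=.
  by rewrite BA tauK.
- exact: push.
Qed.

(** * The duality between the two models *)

Section Reflection.
Context {R : realType} {n : nat}.

(** The first model precomposed with the automorphism [A |-> - A^T] and pushed forward by
    [x |-> - x]; the outer sign is the differential of this reflection. *)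
Definition dual_log_field (A : 'M[R]_n.+1) (x : 'rV[R]_n) : 'rV[R]_n := - log_field (- A^T) (- x).

Lemma sl_opp_tr (A : 'M[R]_n.+1) : sl R n A -> sl R n (- A^T).
Proof. by rewrite /sl /= => A0; rewrite raddfN /= mxtrace_tr A0 oppr0. Qed.

Lemma smooth_opp (W : set 'rV[R]_n) : open W -> smooth_on W (@GRing.opp 'rV[R]_n).
Proof.
move=> oW k; apply/class_CP => // j; apply: (Ck_eq (g := fun x => - x 0 j)) => //.
  by move=> x _; rewrite mxE.
by apply: CkN => //; exact: Ck_coord.
Qed.

Lemma smooth_comp (W V : set 'rV[R]_n) (f g : 'rV[R]_n -> 'rV[R]_n) : open W -> open V ->
  (forall x, W x -> V (f x)) -> smooth_on W f -> smooth_on V g -> smooth_on W (g \o f).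
Proof.
move=> oW oV fWV sf sg k; apply/class_CP => // j.
apply: (Ck_comp (h := fun y => g y 0 j) oW oV fWV); first exact: smooth_coord.
by move=> i; exact: smooth_coord.
Qed.

Lemma is_derive_reflect (F : 'rV[R]_n -> 'rV[R]_n) x v l :
  is_derive (- x) v F l -> is_derive x v (fun y => - F (- y)) l.
Proof.
move=> /is_derive_epsP Fl; apply/is_derive_epsP => e /Fl[d d0 dP]; exists d => // t td.
have := dP (- t); rewrite normrN => /(_ td).
have -> : (- t)^-1 *: (F (- t *: v + - x) - F (- x)) =
    t^-1 *: (- F (- (t *: v + x)) - - F (- x)).
  rewrite invrN (scaleNr t v) -opprD (scaleNr t^-1); move: (F _) (F _) => P Q.
  by rewrite -(scalerN t^-1) opprB opprK addrC.
exact.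
Qed.

Lemma dual_log_field_derive (A B : 'M[R]_n.+1) (x : 'rV[R]_n) :
  'D_(dual_log_field A x) (dual_log_field B) x =
  - 'D_(log_field (- A^T) (- x)) (log_field (- B^T)) (- x).
Proof.
have d v := jac_derive openT (@log_field_smooth R n (- B^T)) v (I : setT (- x)).
have [_ ->] := is_derive_reflect (d (dual_log_field A x)).
by have [_ ->] := d (log_field (- A^T) (- x)); rewrite -mulNmx.
Qed.

Lemma dual_log_field_realization : realization setT dual_log_field.
Proof.
have [ls llin lbr] := @log_field_realization R n.
split=> [A A0|s A B x A0 B0 _|A B x A0 B0 _].
- have inner := smooth_comp openT openT (fun _ _ => I) (smooth_opp openT)
    (ls (- A^T) (sl_opp_tr A0)).
  exact (smooth_comp openT openT (fun _ _ => I) inner (smooth_opp openT)).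
- rewrite /dual_log_field linearP /= opprD -scalerN llin ?opprD ?scalerN //; exact: sl_opp_tr.
- rewrite /lie_bracket !dual_log_field_derive -opprD /dual_log_field; congr (- _).
  rewrite [RHS](_ : _ = lie_bracket (log_field (- A^T)) (log_field (- B^T)) (- x)) //.
  rewrite -lbr //; try exact: sl_opp_tr.
  by rewrite raddfB /= !trmx_mul !mulNmx !mulmxN !opprK opprB.
Qed.

(** Transposition exchanges the root vectors of opposite roots, and [dual_log_field A^T] at [x] is
    [log_field A] at [- x]; so the positive family of the second model comes from the negative
    family of the first, and conversely. *)
Lemma dual_log_field_given_by : given_by dual_log_field X2_pos X2_neg.
Proof.
have root_tr (al be : 'M[R]_n.+1 -> R) (A : 'M[R]_n.+1) : (forall H, be H = - al H) ->
    root_vector al A -> root_vector be A^T.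
  move=> beE [A0 An0 Aal]; split.
  - by rewrite /sl /= mxtrace_tr.
  - by rewrite -(inj_eq trmx_inj) trmxK trmx0.
  move=> H H0 Hd; have HT : H^T = H.
    apply/matrixP => i j; rewrite mxE; case: (eqVneq i j) => [->//|ij].
    by move/is_diag_mxP: Hd => Hd; rewrite !Hd // eq_sym.
  have := congr1 trmx (Aal H H0 Hd); rewrite raddfB /= !trmx_mul HT linearZ /=.
  by move=> /(congr1 -%R); rewrite opprB beE scaleNr.
have log_fieldN A y : log_field (- A) y = - log_field A y :> 'rV[R]_n.
  have lcN a : log_component (- A) a y = - log_component A a y.
    rewrite /log_component; congr (- _); rewrite -[RHS]sumrN.
    by apply: eq_bigr => b _; rewrite mxE mulNr.
  by apply/rowP => k; rewrite !mxE !lcN; ring.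
move=> i; have [[A Apos AE] [B Bneg BE]] := @log_field_given_by R n i.
split.
- exists B^T; first by apply: root_tr Bneg => H; rewrite opprK.
  apply/funext => x.
  by rewrite /dual_log_field trmxK log_fieldN opprK BE /X1_neg /X2_pos mxE opprK.
- exists A^T; first by apply: root_tr Apos.
  apply/funext => x.
  by rewrite /dual_log_field trmxK log_fieldN opprK AE /X1_pos /X2_neg mxE.
Qed.

End Reflection.


(** * Local equivalence with the models *)

Section LocalEquivalence.
Context {R : realType} {n : nat}.
Hypothesis hn : (2 <= n)%N.

Lemma log_field_nofix (x : 'rV[R]_n) : exists C, sl R n C /\ log_field C x <> 0.
Proof.
apply: contrapT => none.
have /colP/(_ (Ordinal hn)) : (const_mx 1 : 'cV[R]_n) = 0.
  apply: (@log_field_spanning R n x) => A A0; rewrite (_ : log_field A x = 0) ?mul0mx //.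
  by apply: contrapT => Ax; apply: none; exists A.
by rewrite !mxE => /eqP; rewrite oner_eq0.
Qed.

Lemma dual_log_field_nofix (x : 'rV[R]_n) : exists C, sl R n C /\ dual_log_field C x <> 0.
Proof.
have [C [C0 Cx]] := log_field_nofix (- x); exists (- C^T); split; first exact: sl_opp_tr.
rewrite /dual_log_field raddfN /= trmxK opprK => /eqP.
by rewrite oppr_eq0 => /eqP.
Qed.

Lemma carries_onto_of_pushes (W : set 'rV[R]_n) (f : 'rV[R]_n -> 'rV[R]_n)
    (rho sigma : 'M[R]_n.+1 -> 'rV[R]_n -> 'rV[R]_n) (tau theta : 'M[R]_n.+1 -> 'M[R]_n.+1) :
  (forall A, sl R n A -> sl R n (tau A)) -> (forall A, sl R n A -> sl R n (theta A)) ->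
  (forall A, sl R n A -> exists2 B, sl R n B & tau B = A) ->
  (forall A, sl R n A -> exists2 B, sl R n B & theta B = A) ->
  (forall A, sl R n A -> pushes_to W f (rho (tau A)) (sigma (theta A))) ->
  carries_onto W f (rho @` sl R n) (sigma @` sl R n).
Proof.
move=> tsl hsl tsurj hsurj push; split=> [_ [A A0 <-]|_ [A A0 <-]].
  have [B B0 <-] := tsurj A A0; exists (sigma (theta B)); last exact: push.
  by exists (theta B) => //; exact: hsl.
have [B B0 <-] := hsurj A A0; exists (rho (tau B)); last exact: push.
by exists (tau B) => //; exact: tsl.
Qed.

(** Every point of [U] has a chart, so all of [U] serves as the set of generic points. The second
    model is reached by following a chart to the first with the reflection [x |-> - x]. *)
Lemma locally_equivalent_log_field (U : set 'rV[R]_n)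
    (rho : 'M[R]_n.+1 -> 'rV[R]_n -> 'rV[R]_n) :
  open U -> realization U rho -> (forall x, U x -> exists C, sl R n C /\ rho C x <> 0) ->
  locally_equivalent U (rho @` sl R n) setT (log_field @` sl R n) /\
  locally_equivalent U (rho @` sl R n) setT (dual_log_field @` sl R n).
Proof.
move=> oU HR nofix; have chart p := log_field_chart (p := p) hn oU HR nofix.
split; exists U; split=> //; try exact: subset_closure.
  move=> p /chart[W [V [f [g [Wp WU loc [tau [tsl tsurj push]]]]]]].
  exists W, V, f, g; split=> //.
  apply: (carries_onto_of_pushes (tau := tau) (theta := id)) => //.
  by move=> A A0; exists A.
move=> p /chart[W [V [f [g [Wp WU [[oW oV] sf sg fg gf] [tau [tsl tsurj push]]]]]]].
have oV' : open [set y | V (- y)].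
  apply/open_radiusP => y Vy; have [d d0 dV] := (open_radiusP V).1 oV _ Vy.
  exists d => // z zy; apply: dV.
  by rewrite -opprD normrN.
exists W, [set y | V (- y)], (fun x => - f x), (fun y => g (- y)); split=> //.
  split=> //.
  - exact: (smooth_comp oW (@openT 'rV[R]_n) (fun _ _ => I) sf (smooth_opp openT)).
  - exact: (smooth_comp oV' oV (fun _ Vy => Vy) (smooth_opp oV') sg).
  - by move=> x /fg[Vfx gfx]; rewrite /= opprK.
  - by move=> y /gf[Wg fgy]; rewrite fgy opprK.
apply: (carries_onto_of_pushes (tau := tau) (theta := fun A => - A^T)) => //.
- by move=> A; exact: sl_opp_tr.
- move=> A A0; exists (- A^T); first exact: sl_opp_tr.
  by rewrite raddfN /= trmxK opprK.
move=> A A0 x Wx; have := push A A0 x Wx.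
rewrite /dual_log_field raddfN /= trmxK !opprK => <-.
have [fd _] := jac_derive oW sf (rho (tau A) x) Wx.
exact: deriveN fd.
Qed.

End LocalEquivalence.

Unset Implicit Arguments.

Theorem corollary3p2 (R : realType) (n : nat) (hn : (2 <= n)%N) :
  exists rho1 rho2 : 'M[R]_n.+1 -> 'rV[R]_n -> 'rV[R]_n,
    [/\ realization setT rho1 /\ given_by rho1 X1_pos X1_neg,
        realization setT rho2 /\ given_by rho2 X2_pos X2_neg,
        forall (U : set 'rV[R]_n) (rho : 'M[R]_n.+1 -> 'rV[R]_n -> 'rV[R]_n),
          open U -> connected U -> realization U rho -> nontrivial U rho ->
          locally_equivalent U (rho @` sl R n) setT (rho1 @` sl R n) /\
          locally_equivalent U (rho @` sl R n) setT (rho2 @` sl R n)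
      & locally_equivalent setT (rho1 @` sl R n) setT (rho2 @` sl R n) /\
        locally_equivalent setT (rho2 @` sl R n) setT (rho1 @` sl R n)].
Proof.
exists log_field, dual_log_field; split.
- by split; [exact: log_field_realization | exact: log_field_given_by].
- by split; [exact: dual_log_field_realization | exact: dual_log_field_given_by].
- move=> U rho oU cU HR nt; apply: locally_equivalent_log_field => // x Ux.
  exact: (no_fixed_point hn oU HR cU nt Ux).
(* Each model is itself a realization without fixed points, so the general equivalence applies to it
   with the other model as target. *)
- have nofix1 x (_ : setT x) := log_field_nofix (R := R) hn x.
  have nofix2 x (_ : setT x) := dual_log_field_nofix (R := R) hn x.
  have [_ eq12] := locally_equivalent_log_field hn openT log_field_realization nofix1.
  by have [eq21 _] := locally_equivalent_log_field hn openT dual_log_field_realization nofix2.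
Qed.
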